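(* Let $\mathbb{K}$ be a field, let $G$ be a non-bipartite graph with vertex set $\{v_1,\dots,v_n\}$, let $S=\mathbb{K}[x_1,\dots,x_n]$, and let $I=I(G)\subseteq S$ be the edge ideal of $G$. Let $p$ be the number of bipartite connected components of $G$. Then for every integer $k\geq 1$, we have ${\rm sdepth}(\overline{I^k})\geq p+1$. In particular, $\overline{I^k}$ satisfies Stanley's inequality for every integer $k\gg 0$ (i.e. there is $k_0$ such that ${\rm depth}(\overline{I^k})\leq {\rm sdepth}(\overline{I^k})$ for all $k\geq k_0$).
   Context: Graphs are finite and simple. The edge ideal of $G$ is $I(G)=(x_ix_j : \{v_i,v_j\}\in E(G))\subseteq S$. For an ideal $J\subseteq S$, $\overline{J}$ denotes its integral closure; if $J$ is a monomial ideal, $\overline{J}$ is the monomial ideal generated by all monomials $u\in S$ such that $u^r\in J^r$ for some integer $r\geq 1$. An isolated vertex counts as a bipartite connected component. Stanley depth: let $M$ be a finitely generated $\mathbb{Z}^n$-graded $S$-module. For a homogeneous $u\in M$ and $Z\subseteq\{x_1,\dots,x_n\}$, the $\mathbb{K}$-subspace $u\mathbb{K}[Z]$ of $M$ generated by all $uv$ with $v$ a monomial in $\mathbb{K}[Z]$ is called a Stanley space of dimension $|Z|$ if it is a free $\mathbb{K}[Z]$-module. A Stanley decomposition $\mathcal{D}$ of $M$ is a decomposition of $M$ (as a $\mathbb{K}$-vector space) as a finite direct sum of Stanley spaces; ${\rm sdepth}(\mathcal{D})$ is the minimum dimension of a Stanley space in $\mathcal{D}$, and ${\rm sdepth}(M)$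 is the maximum of ${\rm sdepth}(\mathcal{D})$ over all Stanley decompositions $\mathcal{D}$ of $M$. By convention ${\rm sdepth}(0)=\infty$. $M$ satisfies Stanley's inequality if ${\rm depth}(M)\leq{\rm sdepth}(M)$. *)

(* Defs.v *)
From HB Require Import structures.
From mathcomp Require Import all_boot all_order all_algebra.
From mathcomp Require Import boolp.
From mathcomp Require Import mpoly.

Set Implicit Arguments.
Unset Strict Implicit.
Unset Printing Implicit Defensive.

Import GRing.Theory.
Local Open Scope ring_scope.

Inductive enat : Type := Fin of nat | Infty.

Definition enat_le (a b : enat) : Prop :=
  match a, b with
  | _, Infty => True
  | Infty, Fin _ => False
  | Fin m, Fin k => (m <= k)%N
  end.

Definition enat_min (a b : enat) : enat :=
  match a, b with
  | Infty, _ => b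
  | _, Infty => a
  | Fin m, Fin k => Fin (minn m k)
  end.

Definition enat_bound (P : enat -> Prop) (b : nat) : bool :=
  `[< forall a, P a -> enat_le a (Fin b) >].

(* Least upper bound; a maximum whenever P is nonempty. *)
Definition enat_sup (P : enat -> Prop) : enat :=
  match pselect (exists b, enat_bound P b) with
  | left bounded => Fin (ex_minn bounded)
  | right _ => Infty
  end.

Section Graphs.
Variables (n : nat) (e : rel 'I_n).

Definition bipartite_on (C : {set 'I_n}) : bool :=
  [exists A : {set 'I_n}, [forall x in C, forall y in C,
    e x y ==> ((x \in A) != (y \in A))]].

Definition bipartite : bool := bipartite_on [set: 'I_n].

Definition components : {set {set 'I_n}} :=
  equivalence_partition (connect e) [set: 'I_n].

Definition num_bipartite_components : nat :=
  #|[set C in components | bipartite_on C]|.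

End Graphs.

Section Ideals.
Variables (K : fieldType) (n : nat).
Local Notation S := {mpoly K[n]}.
Implicit Types (A I J M : S -> Prop) (f g u : S) (Z : {set 'I_n}).

Definition ideal_gen A f : Prop :=
  exists (r : nat) (c g : 'I_r -> S),
    (forall i, A (g i)) /\ f = \sum_i c i * g i.

Definition ideal_mul I J : S -> Prop :=
  ideal_gen (fun h => exists f g, [/\ I f, J g & h = f * g]).

Definition ideal_pow I (k : nat) : S -> Prop :=
  iter k (ideal_mul I) (fun=> True).

Definition integral_closure J f : Prop :=
  exists (r : nat) (a : nat -> S),
    [/\ (0 < r)%N,
        forall i, (1 <= i <= r)%N -> ideal_pow J i (a i) &
        f ^+ r + \sum_(1 <= i < r.+1) a i * f ^+ (r - i) = 0].

Definition edge_ideal (e : rel 'I_n) : S -> Prop :=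
  ideal_gen (fun f => exists i j, e i j /\ f = 'X_i * 'X_j).

(* The notions below concern a Z^n-graded module M; they are spelled out for
   M a monomial ideal of S, given by its membership predicate. *)

Definition in_subalgebra Z f : Prop :=
  forall m : 'X_{1..n}, m \in msupp f -> forall i, m i != 0%N -> i \in Z.

(* Homogeneous for the Z^n-grading of S, in which deg x_i is the i-th unit
   vector. *)
Definition multihomogeneous u : Prop :=
  exists (c : K) (m : 'X_{1..n}), u = c *: 'X_[m].

Definition stanley_space u Z f : Prop :=
  exists2 v, in_subalgebra Z v & f = u * v.

(* u K[Z] is a free K[Z]-module with basis u. *)
Definition stanley_free u Z : Prop :=
  forall v, in_subalgebra Z v -> u * v = 0 -> v = 0.

Definition stanley_decomposition M (r : nat) (u : 'I_r -> S)
    (Z : 'I_r -> {set 'I_n}) : Prop :=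
  [/\ forall i, [/\ M (u i), multihomogeneous (u i) & stanley_free (u i) (Z i)],
      forall f, M f <-> exists g : 'I_r -> S,
        (forall i, stanley_space (u i) (Z i) (g i)) /\ f = \sum_i g i &
      forall g : 'I_r -> S, (forall i, stanley_space (u i) (Z i) (g i)) ->
        \sum_i g i = 0 -> forall i, g i = 0].

Definition sdepth_decomposition (r : nat) (Z : 'I_r -> {set 'I_n}) : enat :=
  \big[enat_min/Infty]_(i < r) Fin #|Z i|.

(* For M = 0 only the empty decomposition exists, so sdepth 0 = Infty. *)
Definition sdepth M : enat :=
  enat_sup (fun d => exists (r : nat) (u : 'I_r -> S) (Z : 'I_r -> {set 'I_n}),
    stanley_decomposition M u Z /\ d = sdepth_decomposition Z).

Definition irrelevant_ideal : S -> Prop :=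
  ideal_gen (fun f => exists i, f = 'X_i).

(* The submodule (fs) M of M. *)
Definition seq_mul (fs : seq S) M : S -> Prop :=
  ideal_mul (ideal_gen (fun f => f \in fs)) M.

Definition regular_sequence M (fs : seq S) : Prop :=
  (forall i, (i < size fs)%N -> forall x, M x ->
     seq_mul (take i fs) M (fs`_i * x) -> seq_mul (take i fs) M x) /\
  ~ (forall x, M x -> seq_mul fs M x).

Definition depth M : enat :=
  if `[< forall x, M x -> x = 0 >] then Infty
  else enat_sup (fun d => exists fs : seq S,
    [/\ forall f, f \in fs -> irrelevant_ideal f,
        regular_sequence M fs & d = Fin (size fs)]).

Definition stanley_inequality M : Prop := enat_le (depth M) (sdepth M).

End Ideals.

(* Main.v *)
Require Import Defs.
From HB Require Import structures.
From mathcomp Require Import mpoly.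
From mathcomp Require Import all_boot all_order all_algebra.
From mathcomp Require Import boolp zify ring.

(** Call an exponent m heavy when sum_i c_i m_i >= 2k for every half-integral
    vertex cover c, that is, every map c from the vertices to {0, 1, 2} with
    c_i + c_j >= 2 along edges. The integral closure of I^k is the monomial
    ideal of the heavy exponents ([integral_closure_edge_ideal_powP]): covers
    are monomial valuations, which integral equations respect
    ([integral_closure_weight]), and by Konig's theorem in the bipartite
    double of the graph ([konig], [heavy_flow]) the square of a heavy
    monomial is a multiple of a product of 2k edges.

    Lower bound for the Stanley depth. The heavy exponents are partitioned
    into boxes b + N^Z with at least p + 1 free directions. On a bipartite
    component C, every exponent has a direction i in C along which the
    minimum weight of a cover on C stays constant, namely one where an
    optimal cover vanishes ([bipartite_escape]); so the level sets of the
    minimum weight split into boxes with a free direction in C. On the union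
    V of the non-bipartite components, which is not empty, a threshold set of
    the minimum weight is closed upward and any vertex is a free direction.
    Minimum weights add up over components, so the heavy exponents form a
    disjoint union of products of such sets ([threshold_box_partition],
    [heavy_blocks]).

    Upper bound for the depth. For large k there is a product of edges and of
    one variable of V, with exponent a, such that the colon of the integral
    closure by x^a is generated by the variables of V and the products x_i
    x_j with i and j on different sides of a bipartite component
    ([colon_corner]). Modulo this ideal the polynomial ring is a tensor
    product of rings, one for each bipartite component, that have a Koszul
    class of degree 1. The product of these classes, multiplied by x^a and
    sent through the connecting map, is a class of degree p + 1 of the
    integral closure; it is not zero because it pairs to 1 with the cone over
    the boundary of a cross-polytope ([koszul_class_cross]). A non-zero
    Koszul class of degree d bounds the length of all regular sequences by d
    ([regular_sequence_le_koszul]). So for large k the depth is at most p +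
    1, which is at most the Stanley depth. *)

Set Implicit Arguments.
Unset Strict Implicit.
Unset Printing Implicit Defensive.

Import GRing.Theory.
Local Open Scope ring_scope.

(** * Polynomials supported on a set of exponents *)

Section SupportedPolynomials.
Variables (K : fieldType) (n : nat).
Local Notation S := {mpoly K[n]}.
Implicit Types (P Q : pred 'X_{1..n}) (f g : S).

Definition supp_in P f : Prop := forall m, m \in msupp f -> P m.

Lemma supp_in0 P : supp_in P 0.
Proof. by move=> m; rewrite msupp0. Qed.

Lemma supp_inD P f g : supp_in P f -> supp_in P g -> supp_in P (f + g).
Proof.
move=> Pf Pg m /msuppD_le; rewrite mem_cat => /orP[].
  exact: Pf.
exact: Pg.
Qed.

Lemma supp_inN P f : supp_in P f -> supp_in P (- f).
Proof. by move=> Pf m; rewrite (perm_mem (msuppN f)); apply: Pf. Qed.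

Lemma supp_in_sum P I (r : seq I) (B : pred I) (F : I -> S) :
  (forall i, B i -> supp_in P (F i)) -> supp_in P (\sum_(i <- r | B i) F i).
Proof.
move=> PF; elim/big_ind: _ => //; first exact: supp_in0.
exact: supp_inD.
Qed.

Lemma supp_inM P Q (R : pred 'X_{1..n}) f g :
  (forall m1 m2, P m1 -> Q m2 -> R (m1 + m2)%MM) ->
  supp_in P f -> supp_in Q g -> supp_in R (f * g).
Proof.
move=> PQR Pf Qg m /msuppM_le /allpairsP[[m1 m2] /= [m1f m2g ->]].
by apply: PQR; [apply: Pf | apply: Qg].
Qed.

Lemma supp_inMr P f g :
  (forall m1 m2, P m2 -> P (m1 + m2)%MM) -> supp_in P g -> supp_in P (f * g).
Proof. by move=> Pup; apply: (@supp_inM predT) => // m1 m2 _; apply: Pup. Qed.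

Lemma supp_inX P m : P m -> supp_in P 'X_[m].
Proof. by move=> Pm m'; rewrite msuppX inE => /eqP ->. Qed.

Lemma supp_in_coef P f m : supp_in P f -> ~~ P m -> f@_m = 0.
Proof.
by move=> Pf nPm; apply/eqP; rewrite mcoeff_eq0; apply: contra nPm => /Pf.
Qed.

End SupportedPolynomials.

(** * Powers of ideals *)

Section IdealPowers.
Variables (K : fieldType) (n : nat).
Local Notation S := {mpoly K[n]}.
Implicit Types (A I J : S -> Prop) (f g : S).

Lemma ideal_gen_mem A f : A f -> ideal_gen A f.
Proof.
by move=> Af; exists 1, (fun=> 1), (fun=> f); rewrite big_ord1 mul1r.
Qed.

Lemma ideal_gen0 A : ideal_gen A 0.
Proof.
by exists 0, (fun=> 0), (fun=> 0); split; [case | rewrite big_ord0].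
Qed.

Lemma ideal_genD A f g : ideal_gen A f -> ideal_gen A g -> ideal_gen A (f + g).
Proof.
move=> [r [c [u [Au ->]]]] [r' [c' [u' [Au' ->]]]].
pose glue (F : 'I_r -> S) (F' : 'I_r' -> S) i :=
  match split i with inl j => F j | inr j => F' j end.
exists (r + r')%N, (glue c c'), (glue u u'); split.
  by move=> i; rewrite /glue; case: (split i).
rewrite big_split_ord /=; congr (_ + _); apply: eq_bigr => i _; rewrite /glue.
  by rewrite (unsplitK (inl i)).
by rewrite (unsplitK (inr i)).
Qed.

Lemma ideal_genMl A f g : ideal_gen A g -> ideal_gen A (f * g).
Proof.
move=> [r [c [u [Au ->]]]]; exists r, (fun i => f * c i), u; split=> //.
by rewrite mulr_sumr; apply: eq_bigr => i _; rewrite mulrA.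
Qed.

Lemma ideal_gen_ind A (Q : S -> Prop) :
  Q 0 -> (forall f g, Q f -> Q g -> Q (f + g)) ->
  (forall c f, A f -> Q (c * f)) -> forall f, ideal_gen A f -> Q f.
Proof.
move=> Q0 QD QA f [r [c [u [Au ->]]]].
by elim/big_ind: _ => // i _; apply: QA.
Qed.

Lemma ideal_pow0 J k : ideal_pow J k 0.
Proof. by case: k => [//|k]; apply: ideal_gen0. Qed.

Lemma ideal_powD J k f g :
  ideal_pow J k f -> ideal_pow J k g -> ideal_pow J k (f + g).
Proof. by case: k => [//|k]; apply: ideal_genD. Qed.

Lemma ideal_powMl J k f g : ideal_pow J k g -> ideal_pow J k (f * g).
Proof. by case: k => [//|k]; apply: ideal_genMl. Qed.

Lemma ideal_pow_mul J i j f g :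
  ideal_pow J i f -> ideal_pow J j g -> ideal_pow J (i + j) (f * g).
Proof.
move=> + Jg; elim: i f => [|i IH] f; first by move=> _; apply: ideal_powMl.
apply: (@ideal_gen_ind _ (fun h => ideal_pow J (i.+1 + j) (h * g))).
- by rewrite mul0r; apply: ideal_pow0.
- by move=> f1 f2 J1 J2; rewrite mulrDl; apply: ideal_powD.
move=> c _ [f1 [f2 [J1 /IH J2 ->]]]; rewrite -mulrA; apply: ideal_powMl.
by apply: ideal_gen_mem; exists f1, (f2 * g); rewrite mulrA.
Qed.

Lemma ideal_pow_prod I (s : seq S) :
  (forall f, f \in s -> I f) -> ideal_pow I (size s) (\prod_(f <- s) f).
Proof.
elim: s => [//|f s IH] Is; rewrite big_cons; apply: ideal_gen_mem.
exists f, (\prod_(g <- s) g); split=> //; first by apply: Is; rewrite mem_head.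
by apply: IH => g gs; apply: Is; rewrite inE gs orbT.
Qed.

End IdealPowers.

(** * Integral closure and the Rees algebra *)

Section Rees.
Variables (K : fieldType) (n : nat) (J : {mpoly K[n]} -> Prop).
Local Notation S := {mpoly K[n]}.

(** The polynomials lying in the Rees algebra S[JT], which is the sum of the
    J^i T^i. *)
Definition rees : {pred {poly S}} :=
  fun p => `[< forall i, ideal_pow J i p`_i >].

Lemma reesP (p : {poly S}) :
  reflect (forall i, ideal_pow J i p`_i) (p \in rees).
Proof. exact: asboolP. Qed.

Lemma rees_subring : subring_closed rees.
Proof.
split.
- by apply/reesP => i; rewrite coef1; case: i => [|i] //; apply: ideal_pow0.
- move=> p q /reesP Jp /reesP Jq; apply/reesP => i; rewrite coefB -mulN1r.
  by apply: ideal_powD => //; apply: ideal_powMl.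
move=> p q /reesP Jp /reesP Jq; apply/reesP => i; rewrite coefM.
elim/big_ind: _ => [||j _]; [exact: ideal_pow0|exact: ideal_powD|].
rewrite -[X in ideal_pow J X](subnKC (leq_ord j)).
exact: ideal_pow_mul.
Qed.

HB.instance Definition _ :=
  GRing.isSubringClosed.Build {poly S} rees rees_subring.

Record rees_alg := ReesAlg { rees_val :> {poly S}; _ : rees_val \in rees }.
HB.instance Definition _ := [isSub for rees_val].
HB.instance Definition _ := [Choice of rees_alg by <:].
HB.instance Definition _ := [SubChoice_isSubComNzRing of rees_alg by <:].

(** If f T satisfies a monic equation over the Rees algebra, the coefficient
    of T^r in that equation, r being its degree, is an equation of integral
    dependence of f over J. Integral elements over a ring are closed under
    sums, so no graded version of that fact is needed. *)
Lemma integral_closure_rees (f : S) :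
  integralOver (val : rees_alg -> {poly S}) (f *: 'X) -> integral_closure J f.
Proof.
case=> p p_monic p_root; set r := (size p).-1.
have szp : size p = r.+1 by rewrite prednK // size_poly_gt0 monic_neq0.
have r_gt0 : (0 < r)%N.
  rewrite lt0n; apply: contraL p_root => /eqP r0.
  have p1 : p = 1.
    rewrite [p]size1_polyC ?szp ?r0 //; congr _%:P.
    by rewrite -(monicP p_monic) lead_coefE szp r0.
  by rewrite p1 rmorph1 root1.
pose a j : S := (val p`_(r - j))`_j.
have aJ j : ideal_pow J j (a j) by have /reesP := valP (p`_(r - j)); apply.
exists r, a; split=> //.
move: p_root; rewrite /root horner_coef.
rewrite size_map_poly_id0; last first.
  by rewrite (monicP p_monic) rmorph1 oner_neq0.
rewrite szp => /eqP/(congr1 (fun q : {poly S} => q`_r)); rewrite coef0 coef_sum.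
have E (i : 'I_r.+1) : ((map_poly val p)`_i * (f *: 'X) ^+ i)`_r
    = a (r - i)%N * f ^+ (r - (r - i))%N.
  rewrite coef_map /= exprZn -scalerAr coefZ coefMXn ltnNge leq_ord /=.
  by rewrite /a (subKn (leq_ord i)) mulrC.
under eq_bigr do rewrite E.
rewrite -(big_mkord predT (fun i => a (r - i)%N * f ^+ (r - (r - i))%N)).
rewrite big_nat_rev /= add0n big_nat_recl // => sum0; rewrite -[RHS]sum0;
  congr (_ + _).
  rewrite subn1 /= subnn subn0 /a subn0.
  suff -> : p`_r = 1 by rewrite rmorph1 coef1 mul1r.
  by apply/eqP; rewrite -[_ == _](monicE).
rewrite big_add1 /=; apply: eq_big_nat => i /andP[_ ir].
by congr (a _ * f ^+ _); lia.
Qed.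

End Rees.

Section IntegralMonomials.
Variables (K : fieldType) (n : nat) (J : {mpoly K[n]} -> Prop).
Local Notation S := {mpoly K[n]}.

Lemma integral_of_square (u : S) : ideal_pow J 2 (u ^+ 2) ->
  integralOver (val : rees_alg J -> {poly S}) (u *: 'X).
Proof.
move=> Ju2.
have u2_rees : (u *: 'X) ^+ 2 \in rees J.
  apply/reesP => i; rewrite exprZn coefZ coefXn.
  by case: eqP => [->|_]; rewrite ?mulr1 // mulr0; apply: ideal_pow0.
exists ('X^2 - (ReesAlg u2_rees)%:P); first by rewrite monicXnsubC.
rewrite /root (_ : map_poly _ _ = 'X^2 - ((u *: 'X) ^+ 2)%:P).
  by rewrite !hornerE subrr.
apply: (etrans (raddfB (map_poly (val : rees_alg J -> {poly S})) _ _)).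
congr (_ - _); first exact: (map_polyXn (val : rees_alg J -> {poly S})).
exact: (map_polyC (val : rees_alg J -> {poly S})).
Qed.

Lemma integral_scale (c : S) (q : {poly S}) :
  integralOver (val : rees_alg J -> {poly S}) q ->
  integralOver (val : rees_alg J -> {poly S}) (c *: q).
Proof.
have c_rees : c%:P \in rees J.
  by apply/reesP => -[|i]; rewrite coefC //; apply: ideal_pow0.
by rewrite -mul_polyC; apply/integral_mul/(integral_id _ (ReesAlg c_rees)).
Qed.

(** The relation u^2 in J^2 is itself an equation of integral dependence for
    the monomial u; the terms of f are then added up in the Rees algebra. *)
Lemma integral_closure_of_squares (f : S) :
  (forall m, m \in msupp f -> ideal_pow J 2 ('X_[m] ^+ 2)) ->
  integral_closure J f.
Proof.
move=> Jf; apply: integral_closure_rees.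
rewrite [f]mpolyE scaler_suml big_seq; elim/big_ind: _ => [|p q|m mf].
- exact: integral0.
- exact: integral_add.
rewrite -mul_mpolyC -scalerA; apply: integral_scale.
exact/integral_of_square/Jf.
Qed.

End IntegralMonomials.

(** * Monomial valuations and integral closure *)

Section Weights.
Variables (K : fieldType) (n : nat).
Local Notation S := {mpoly K[n]}.
Implicit Types (w : 'X_{1..n} -> nat) (f g : S) (I J : S -> Prop).

Lemma ideal_pow_weight w I t :
  {morph w : m1 m2 / (m1 + m2)%MM >-> (m1 + m2)%N} ->
  (forall f, I f -> supp_in (fun m => t <= w m)%N f) ->
  forall k f, ideal_pow I k f -> supp_in (fun m => k * t <= w m)%N f.
Proof.
move=> wD It; elim=> [|k IH] f; first by [].
apply: ideal_gen_ind => [|f1 f2|c _ [f1 [f2 [/It f1t /IH f2t ->]]]].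
- exact: supp_in0.
- exact: supp_inD.
apply: supp_inMr => [m1 m2|]; first by rewrite wD; lia.
by apply: supp_inM f1t f2t => m1 m2; rewrite wD; lia.
Qed.

Lemma supp_in_exp w t r f :
  {morph w : m1 m2 / (m1 + m2)%MM >-> (m1 + m2)%N} -> w 0%MM = 0%N ->
  supp_in (fun m => t <= w m)%N f -> supp_in (fun m => r * t <= w m)%N (f ^+ r).
Proof.
move=> wD w0 ft; elim: r => [|r IH]; first by [].
by rewrite exprS; apply: supp_inM ft IH => m1 m2; rewrite wD; lia.
Qed.

(** Additive weights on exponents behave like valuations. If the lowest weight
    v of f were below t, all terms a_i f^(r-i) of an integral equation would
    have weight above r v, while the r-th power of the lowest weight form g of
    f is non-zero of weight exactly r v. *)
Lemma integral_closure_weight w J t :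
  {morph w : m1 m2 / (m1 + m2)%MM >-> (m1 + m2)%N} -> w 0%MM = 0%N ->
  (forall f, J f -> supp_in (fun m => t <= w m)%N f) ->
  forall f, integral_closure J f -> supp_in (fun m => t <= w m)%N f.
Proof.
move=> wD w0 Jt f [r [a [r_gt0 aJ fr0]]] m0 m0f; rewrite leqNgt;
  apply/negP => m0t.
have [v [v_t fv [m1 m1f m1v]]] : exists v, [/\ (v < t)%N,
    supp_in (fun m => v <= w m)%N f & exists2 m, m \in msupp f & w m = v].
  have ex : exists v, has (fun m => w m == v) (msupp f).
    by exists (w m0); apply/hasP; exists m0.
  have [v /hasP[m mf /eqP mv] v_min] := ex_minnP ex.
  have v_le m' : m' \in msupp f -> (v <= w m')%N.
    by move=> m'f; apply: v_min; apply/hasP; exists m'.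
  exists v; split=> //; last by exists m.
  by apply: leq_ltn_trans m0t; apply: v_le.
(* g is the form of lowest weight of f *)
pose g : S := \sum_(m <- msupp f | w m == v) f@_m *: 'X_[m].
have g_supp : supp_in (fun m => w m == v)%N g.
  by apply: supp_in_sum => m mv m' /msuppZ_le; rewrite msuppX inE => /eqP ->.
have fg : supp_in (fun m => v < w m)%N (f - g).
  rewrite {1}[f]mpolyE (bigID (fun m => w m == v)) /= addrAC subrr add0r.
  rewrite big_seq_cond; apply: supp_in_sum => m /andP[/fv mv nv] m' /msuppZ_le.
  by rewrite msuppX inE => /eqP ->; rewrite ltn_neqAle eq_sym nv.
have g_neq0 : g != 0.
  apply: contraTneq m1f => g0; move: fg; rewrite g0 subr0 => fg.
  by apply/negP => /fg; rewrite m1v ltnn.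
have frg : supp_in (fun m => r * v < w m)%N (f ^+ r).
  have -> : f ^+ r = - \sum_(1 <= i < r.+1) a i * f ^+ (r - i).
    by apply/eqP; rewrite -addr_eq0 fr0.
  apply: supp_inN; rewrite big_seq_cond; apply: supp_in_sum => i.
  rewrite mem_index_iota ltnS => /andP[/andP[i1 ir] _].
  have ai := ideal_pow_weight wD Jt (aJ i (introT andP (conj i1 ir))).
  have fi := supp_in_exp (r := r - i) wD w0 fv.
  by apply: supp_inM ai fi => m m'; rewrite wD; nia.
have gr_supp : supp_in (fun m => w m == r * v)%N (g ^+ r).
  elim: {+}r => [|s IH]; first by rewrite expr0 => m;
    rewrite msupp1 inE => /eqP->; rewrite w0.
  by rewrite exprS; apply: supp_inM g_supp IH => m m' /eqP mE /eqP m'E;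
    rewrite wD mE m'E mulSn.
have fgr : supp_in (fun m => r * v < w m)%N (f ^+ r - g ^+ r).
  rewrite subrXX; have gv : supp_in (fun m => v <= w m)%N g.
    by move=> m /g_supp /eqP ->.
  case: (r) (r_gt0) => // s _.
  have sum_supp : supp_in (fun m => s * v <= w m)%N
      (\sum_(i < s.+1) f ^+ (s.+1.-1 - i) * g ^+ i).
    apply: supp_in_sum => i _.
    have := @supp_inM _ _ _ _ (fun m => s * v <= w m)%N _ _ _
      (supp_in_exp (r := s - i) wD w0 fv) (supp_in_exp (r := i) wD w0 gv).
    by apply=> m m'; rewrite wD; have := leq_ord i; nia.
  by apply: supp_inM fg sum_supp => m m'; rewrite wD; nia.
have : g ^+ r == 0.
  rewrite -msupp_eq0; case E : (msupp (g ^+ r)) => [//|m s].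
  have mg : m \in msupp (g ^+ r) by rewrite E mem_head.
  have : (r * v < w m)%N.
    apply: (supp_inD frg (supp_inN fgr) (m := m)).
    by rewrite subKr.
  by rewrite (eqP (gr_supp m mg)) ltnn.
by rewrite expf_eq0 (negPf g_neq0) andbF.
Qed.

End Weights.

(** * Konig's theorem for bipartite graphs *)

Section Konig.
Variables T1 T2 : finType.
Implicit Types (E : {set T1 * T2}).

Definition vertex_cover E (C1 : {set T1}) (C2 : {set T2}) : bool :=
  [forall p in E, (p.1 \in C1) || (p.2 \in C2)].

Lemma vertex_coverP E (C1 : {set T1}) (C2 : {set T2}) :
  reflect (forall p, p \in E ->
    (p.1 \in C1) || (p.2 \in C2)) (vertex_cover E C1 C2).
Proof. exact: forall_inP. Qed.

Definition covers_ge K E : Prop :=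
  forall C1 C2, vertex_cover E C1 C2 -> (K <= #|C1| + #|C2|)%N.

(** A cover of the remaining edges that has fewer than K vertices cannot
    contain an end of p, since it would then cover p as well. *)
Lemma critical_edge K E p : ~ covers_ge K (E :\ p) ->
  covers_ge K E ->
  exists (C1 : {set T1}) (C2 : {set T2}),
    [/\ (#|C1| + #|C2| < K)%N, vertex_cover (E :\ p) C1 C2,
                    p.1 \notin C1 & p.2 \notin C2].
Proof.
move=> nK EK.
have [C1 /existsNP[C2 /not_implyP[cov /negP ltK]]] := (existsNP _).2 nK.
rewrite -ltnNge in ltK; exists C1, C2; split=> //; apply/negP => pC.
  suff /EK : vertex_cover E C1 C2 by lia.
  apply/vertex_coverP => q qE; have [->|q_p] := eqVneq q p; first by rewrite pC.
  by apply: (elimT (vertex_coverP _ _ _) cov); rewrite !inE q_p.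
suff /EK : vertex_cover E C1 C2 by lia.
apply/vertex_coverP => q qE; have [->|q_p] := eqVneq q p.
  by rewrite pC orbT.
by apply: (elimT (vertex_coverP _ _ _) cov); rewrite !inE q_p.
Qed.

(** In an edge-minimal graph with cover bound K no two edges x y, x y' share
    x. Otherwise take the small covers (C1, C2) and (D1, D2) missing them.
    Both (C1 :&: D1, C2 :|: D2) and (x |: C1 :|: D1, C2 :&: D2) cover all
    edges, and their sizes add up to at most 2K - 1. *)
Lemma critical_edges_disjoint K E :
  (forall p, p \in E -> ~ covers_ge K (E :\ p)) ->
  covers_ge K E ->
  {in E &, injective (fun p : T1 * T2 => p.1)}.
Proof.
move=> crit EK [x y] [x' y'] /= pE qE xx'; subst x'.
apply/eqP; rewrite xpair_eqE eqxx /=; apply/negP => /negP yy'.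
have [C1 [C2 [ltC covC nxC nyC]]] := critical_edge (crit _ pE) EK.
have [D1 [D2 [ltD covD nxD nyD]]] := critical_edge (crit _ qE) EK.
rewrite /= in nxC nyC nxD nyD.
have yD : y \in D2.
  have := elimT (vertex_coverP _ _ _) covD (x, y);
    rewrite !inE xpair_eqE eqxx /= yy'.
  by rewrite pE (negPf nxD); apply.
have y'C : y' \in C2.
  have := elimT (vertex_coverP _ _ _) covC (x, y');
    rewrite !inE xpair_eqE eqxx /=.
  by rewrite eq_sym yy' qE (negPf nxC); apply.
have cov1 : vertex_cover E (C1 :&: D1) (C2 :|: D2).
  apply/vertex_coverP => q qE0; rewrite !inE.
  have [->|nqp] := eqVneq q (x, y); first by rewrite /= yD !orbT.
  have [->|nqp'] := eqVneq q (x, y'); first by rewrite /= y'C !orbT.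
  have := elimT (vertex_coverP _ _ _) covC q; rewrite !inE nqp qE0 => /(_ isT).
  have := elimT (vertex_coverP _ _ _) covD q; rewrite !inE nqp' qE0 => /(_ isT).
  by do 4!case: (_ \in _).
have cov2 : vertex_cover E (x |: (C1 :|: D1)) (C2 :&: D2).
  apply/vertex_coverP => q qE0; rewrite !inE.
  have [->|nqp] := eqVneq q (x, y); first by rewrite /= eqxx.
  have [->|nqp'] := eqVneq q (x, y'); first by rewrite /= eqxx.
  have := elimT (vertex_coverP _ _ _) covC q; rewrite !inE nqp qE0 => /(_ isT).
  have := elimT (vertex_coverP _ _ _) covD q; rewrite !inE nqp' qE0 => /(_ isT).
  by case: (_ == _) => //; do 4!case: (_ \in _).
move: (EK _ _ cov1) (EK _ _ cov2) ltC ltD (cardsUI C1 D1) (cardsUI C2 D2).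
rewrite cardsU1 !inE (negPf nxC) (negPf nxD) /=.
by clear; lia.
Qed.

End Konig.

Section KonigTheorem.

Lemma covers_ge_swap (T1 T2 : finType) K (E : {set T1 * T2}) :
  covers_ge K E ->
  covers_ge K [set (p.2, p.1) | p in E].
Proof.
move=> EK C1 C2 /vertex_coverP cov; rewrite addnC; apply: EK.
apply/vertex_coverP => p pE; rewrite orbC; apply: (cov (p.2, p.1)).
by apply/imsetP; exists p.
Qed.

(** Deleting edges as long as the cover bound survives ends in a graph whose
    edges are pairwise disjoint; its left endpoints form a cover, so it has at
    least K edges. *)
Theorem konig (T1 T2 : finType) K (E : {set T1 * T2}) :
  covers_ge K E ->
  exists M : {set T1 * T2}, [/\ M \subset E, (K <= #|M|)%N,
    {in M &, injective (fun p : T1 * T2 => p.1)} &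
    {in M &, injective (fun p : T1 * T2 => p.2)}].
Proof.
have [m] := ubnP #|E|; elim: m E => // m IH E ltm EK.
have [[p pE Ep]|crit] := pselect (exists2 p, p \in E & covers_ge K (E :\ p)).
  have [|M [ME KM M1 M2]] := IH _ _ Ep; first by rewrite (cardsD1 p) pE in ltm.
  by exists M; split=> //; apply: subset_trans ME (subD1set _ _).
have {}crit p : p \in E -> ~ covers_ge K (E :\ p).
  by move=> pE Ep; apply: crit; exists p.
have inj1 := critical_edges_disjoint crit EK.
exists E; split=> //.
  have cov : vertex_cover E [set p.1 | p in E] set0.
    by apply/vertex_coverP => p pE; rewrite imset_f.
  by have := EK _ _ cov; rewrite cards0 addn0 card_in_imset.
pose sw (p : T1 * T2) := (p.2, p.1).
have swI : injective sw by move=> [x y] [x' y'] [-> ->].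
move=> p q pE qE pq2; apply: swI.
apply: (critical_edges_disjoint (K := K) _ (covers_ge_swap EK)).
- move=> _ /imsetP[r rE ->] rK; apply: (crit r rE) => C1 C2 /vertex_coverP cov.
  rewrite addnC; apply: rK; apply/vertex_coverP => s; rewrite !inE => /andP[sr].
  case/imsetP => t tE s_t; rewrite s_t /= orbC; apply: cov;
    rewrite !inE tE andbT.
  by apply: contraNneq sr => <-; rewrite s_t.
- by apply/imsetP; exists p.
- by apply/imsetP; exists q.
exact: pq2.
Qed.

End KonigTheorem.

(** * Half-integral vertex covers and powers of edge ideals *)

Section HalfIntegralCovers.
Variables (n : nat) (e : rel 'I_n).
Implicit Types (c : {ffun 'I_n -> 'I_3}) (W : {set 'I_n}) (m : 'X_{1..n}).

Definition half_cover c : bool :=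
  [forall i, forall j, e i j ==> (2 <= c i + c j)%N].

Lemma half_coverP c :
  reflect (forall i j, e i j -> (2 <= c i + c j)%N) (half_cover c).
Proof.
apply: (iffP forallP) => H i; first by move=> j; apply/implyP/(forallP (H i)).
by apply/forallP => j; apply/implyP/H.
Qed.

Definition weight W c m : nat := (\sum_(i in W) c i * m i)%N.

Lemma weightD W c : {morph weight W c : m1 m2 / (m1 + m2)%MM >-> (m1 + m2)%N}.
Proof.
move=> m1 m2; rewrite /weight -big_split /=.
by apply: eq_bigr => i _; rewrite mnmDE mulnDr.
Qed.

Lemma weight0 W c : weight W c 0%MM = 0%N.
Proof. by rewrite /weight big1 // => i _; rewrite mnm0E muln0. Qed.

Lemma weight1 W c i :
  weight W c U_(i)%MM = (if i \in W then c i : nat else 0%N).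
Proof.
rewrite /weight (eq_bigr (fun j => if j == i then c j : nat else 0%N));
  last first.
  by move=> j _; rewrite mnm1E eq_sym; case: eqP => _; rewrite ?muln0 ?muln1.
rewrite -big_mkcondr /=; case: ifP => iW.
  rewrite (big_pred1 i) // => j; rewrite /= andbC.
  by case: eqP => [->|]; rewrite ?iW.
by rewrite big_pred0 // => j; case: eqP => [->|]; rewrite ?iW ?andbF.
Qed.

(** The exponents of the integral closure of the k-th power of the edge ideal.
    Weights are doubled to stay in the natural numbers: a cover by 0, 1/2, 1
    becomes a cover by 0, 1, 2, and the bound k becomes 2k. *)
Definition heavy k m : bool :=
  [forall c, half_cover c ==> (2 * k <= weight [set: 'I_n] c m)%N].

Lemma heavyP k m :
  reflect (forall c, half_cover c -> (2 * k <= weight [set: 'I_n] c m)%N)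
          (heavy k m).
Proof. by apply: (iffP forallP) => H c; apply/implyP/H. Qed.

Lemma heavyDl k m1 m2 : heavy k m2 -> heavy k (m1 + m2)%MM.
Proof.
by move=> /heavyP H; apply/heavyP => c /H; rewrite weightD; lia.
Qed.

End HalfIntegralCovers.

Section IntegralClosureOfEdgeIdealPowers.
Variables (K : fieldType) (n : nat) (e : rel 'I_n).
Hypothesis e_sym : symmetric e.
Local Notation S := {mpoly K[n]}.

Lemma edge_ideal_weight c : half_cover e c -> forall f : S,
  edge_ideal e f -> supp_in (fun m => 2 <= weight [set: 'I_n] c m)%N f.
Proof.
move=> /half_coverP cov; apply: ideal_gen_ind => [|f g|f _ [i [j [eij ->]]]].
- exact: supp_in0.
- exact: supp_inD.
rewrite -mpolyXD; apply: supp_inMr => [m1 m2|]; first by rewrite weightD; lia.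
by apply: supp_inX; rewrite weightD !weight1 !inE; apply: cov.
Qed.

Lemma card_copies m (P : pred 'I_n) :
  #|[set x : {v : 'I_n & 'I_(m v)} | P (tag x)]| = (\sum_(v | P v) m v)%N.
Proof.
rewrite -sum1_card (eq_bigl (fun x => P (tag x) && true)); last first.
  by move=> x; rewrite inE andbT.
rewrite -(sig_big_dep _ (fun _ => predT) (fun _ _ => 1%N)) /=.
by apply: eq_bigr => v _; rewrite sum1_card card_ord.
Qed.

(** Max-flow duality for half-integral covers. In the bipartite double of the
    graph, with each vertex v replaced by m v copies on either side, a vertex
    cover (C1, C2) gives the half-integral cover counting the sides on which
    all copies of v are chosen. So all vertex covers have at least 2k
    elements, and a matching of that size is a list of 2k edges using each
    vertex at most 2 m v times, m v times on either side. *)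
Lemma heavy_flow k m : heavy e k m ->
  exists s : seq ('I_n * 'I_n),
    [/\ size s = (2 * k)%N, all (fun p => e p.1 p.2) s &
    (\sum_(p <- s) (U_(p.1) + U_(p.2)) <= m *+ 2)%MM].
Proof.
move=> /heavyP hm.
pose T := {v : 'I_n & 'I_(m v)}.
pose E : {set T * T} := [set p | e (tag p.1) (tag p.2)].
have EK : covers_ge (2 * k) E.
  move=> C1 C2 /vertex_coverP cov.
  pose full (C : {set T}) v :=
    [forall t : 'I_(m v), Tagged (fun v => 'I_(m v)) t \in C].
  have full_le C : (\sum_(v | full C v) m v <= #|C|)%N.
    rewrite -card_copies; apply/subset_leq_card/subsetP => -[v t].
    by rewrite inE => /forallP /(_ t).
  pose c : {ffun 'I_n -> 'I_3} := [ffun v => inord (full C1 v + full C2 v)].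
  have cE v : c v = (full C1 v + full C2 v)%N :> nat.
    by rewrite ffunE inordK //; case: (full C1 v); case: (full C2 v).
  have c_cov : half_cover e c.
    apply/half_coverP => i j eij; rewrite !cE.
    have H x y : e x y -> full C1 x || full C2 y.
      move=> exy; apply: contraT; rewrite negb_or => /andP[].
      case/forallPn => s sC /forallPn[t tC].
      have := cov (Tagged (fun v => 'I_(m v)) s, Tagged (fun v => 'I_(m v)) t).
      by rewrite !inE (negPf sC) (negPf tC); apply.
    have := H i j eij; have := H j i; rewrite e_sym => /(_ eij).
    by do 4!case: (full _ _).
  apply: leq_trans (hm c c_cov) _.
  apply: leq_trans (leq_add (full_le C1) (full_le C2)).
  rewrite /weight big_mkcond /= [X in (_ <= X + _)%N]big_mkcond /=.
  rewrite [X in (_ <= _ + X)%N]big_mkcond /= -big_split /=;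
    apply: leq_sum => v _.
  by rewrite inE cE; case: (full C1 v); case: (full C2 v); lia.
have [M [/subsetP ME KM M1 M2]] := konig EK.
pose s := [seq (tag p.1, tag p.2) | p <- take (2 * k) (enum M)].
exists s; split.
- by rewrite size_map size_takel // -cardE.
- apply/allP => x /mapP[p /mem_take]; rewrite mem_enum => /ME;
  rewrite inE => ep ->.
  exact: ep.
apply/mnm_lepP => i; rewrite mnm_sumE mulmnE.
have half (f : T * T -> T) : {in M &, injective f} ->
    (\sum_(p <- take (2 * k) (enum M)) (tag (f p) == i) <= m i)%N.
  move=> f_inj; rewrite -(big_pred1_eq addn i (fun v => m v)) -card_copies.
  apply: leq_trans (_ : (\sum_(p in M) (tag (f p) == i) <= _)%N).
    rewrite -big_enum -[X in (_ <= \sum_(p <- X) _)%N](cat_take_drop (2 * k)).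
    by rewrite big_cat leq_addr.
  rewrite -big_mkcondr sum1_card -(card_in_imset (f := f)); last first.
    by move=> p q /andP[pM _] /andP[qM _]; apply: f_inj.
  apply/subset_leq_card/subsetP => _ /imsetP[p /andP[_ pi] ->].
  by rewrite inE.
rewrite muln2 -addnn (leq_trans _ (leq_add (half _ M1) (half _ M2))) //.
rewrite big_map -big_split /=; apply/eq_leq/eq_bigr => p _.
by rewrite mnmDE !mnm1E.
Qed.

(** Each half-integral cover is a monomial valuation of value at least 2k on
    the k-th power, hence on its integral closure. Conversely, the 2k edges
    extracted from a heavy exponent m show that the square of x^m lies in the
    square of the k-th power. *)
Lemma integral_closure_edge_ideal_powP k (f : S) :
  integral_closure (ideal_pow (edge_ideal e) k) f <-> supp_in (heavy e k) f.
Proof.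
split=> [fI m mf|fP].
  apply/heavyP => c c_cov; rewrite mulnC.
  apply: (integral_closure_weight (weightD _ c) (weight0 _ c) _ fI) mf.
  move=> g gI; apply: (ideal_pow_weight (weightD _ c) _ gI).
  exact: edge_ideal_weight.
apply: integral_closure_of_squares => m /fP /heavy_flow[s [sz_s es le_s]].
rewrite mpolyXn -(submK le_s) mpolyXD; apply: ideal_powMl.
have XE (t : seq ('I_n * 'I_n)) : 'X_[\sum_(p <- t) (U_(p.1) + U_(p.2))] =
    \prod_(f <- [seq 'X_(p.1) * 'X_(p.2) | p <- t]) f :> S.
  rewrite big_map (big_morph _ (@mpolyXD n K) (@mpolyX0 n K)).
  by apply: eq_bigr => p _; rewrite mpolyXD.
have powE (t : seq ('I_n * 'I_n)) : size t = k -> all (fun p => e p.1 p.2) t ->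
    ideal_pow (@edge_ideal K n e) k 'X_[\sum_(p <- t) (U_(p.1) + U_(p.2))].
  move=> <- /allP et; rewrite XE -(size_map (fun p => 'X_(p.1) * 'X_(p.2) : S)).
  apply: ideal_pow_prod => _ /mapP[p /et ep ->]; apply: ideal_gen_mem.
  by exists p.1, p.2.
rewrite -(cat_take_drop k s) big_cat mpolyXD /= -[_ * 'X_[_]]mulr1 -mulrA.
move: es; rewrite -{1}(cat_take_drop k s) all_cat => /andP[et ed].
apply: ideal_gen_mem; eexists _, _; split; last by [].
  by apply: powE => //; rewrite size_takel // sz_s; lia.
apply: ideal_gen_mem; eexists _, _; split; last by []; last by [].
by apply: powE => //; rewrite size_drop sz_s; lia.
Qed.

End IntegralClosureOfEdgeIdealPowers.

(** * Partitions of exponent sets into boxes *)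

Section BoxPartitions.
Variable n : nat.
Local Notation mon := 'X_{1..n}.
Implicit Types (W Z : {set 'I_n}) (a b : mon) (X Y : pred mon).

(** The box with corner b and free directions Z, seen through the coordinates
    in W only: its other coordinates are arbitrary. This makes products over
    disjoint coordinate sets plain intersections. *)
Definition box W (bZ : mon * {set 'I_n}) a : bool :=
  [forall i in W, if i \in bZ.2 then bZ.1 i <= a i else a i == bZ.1 i]%N.

Lemma boxP W (bZ : mon * {set 'I_n}) a :
  reflect (forall i, i \in W ->
             if i \in bZ.2 then bZ.1 i <= a i else a i == bZ.1 i)%N
          (box W bZ a).
Proof. exact: forall_inP. Qed.

(** Counting the boxes that contain a expresses in one equation that the boxes
    lie in X, cover X and are disjoint. *)
Definition box_partition W d X : Prop :=
  exists s : seq (mon * {set 'I_n}),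
    (forall bZ, bZ \in s -> bZ.2 \subset W /\ (d <= #|bZ.2|)%N) /\
    (forall a, count (fun bZ => box W bZ a) s = X a).

Lemma eq_box_partition W d X Y :
  X =1 Y -> box_partition W d X -> box_partition W d Y.
Proof. by move=> XY [s [sW sX]]; exists s; split=> // a; rewrite sX XY. Qed.

Lemma box_partition_sum (T : eqType) (J : seq T) W d (X : T -> pred mon) Y :
  (forall j, j \in J -> box_partition W d (X j)) ->
  (forall a, \sum_(j <- J) X j a = Y a)%N ->
  box_partition W d Y.
Proof.
move=> Xbp XY.
suff [s [sW sE]] : exists s : seq (mon * {set 'I_n}),
    (forall bZ, bZ \in s -> bZ.2 \subset W /\ (d <= #|bZ.2|)%N) /\
    (forall a, count (fun bZ => box W bZ a) s = \sum_(j <- J) X j a)%N.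
  by exists s; split=> // a; rewrite sE XY.
elim: J Xbp {XY} => [|j J IH] Xbp.
  by exists [::]; split=> // a; rewrite big_nil.
have [|s [sW sE]] := IH; first by move=> i iJ; apply: Xbp; rewrite inE iJ orbT.
have [s' [sW' sE']] := Xbp j (mem_head _ _).
exists (s' ++ s); split=> [bZ|a]; last by rewrite count_cat sE' sE big_cons.
by rewrite mem_cat => /orP[/sW'|/sW].
Qed.

Lemma box_partition_prod W1 W2 d1 d2 X Y : [disjoint W1 & W2] ->
  box_partition W1 d1 X -> box_partition W2 d2 Y ->
  box_partition (W1 :|: W2) (d1 + d2) (fun a => X a && Y a).
Proof.
move=> W12 [s1 [s1W s1X]] [s2 [s2W s2Y]].
pose glue (x y : mon * {set 'I_n}) : mon * {set 'I_n} :=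
  ([multinom (if i \in W1 then x.1 i else y.1 i) | i < n], x.2 :|: y.2).
exists [seq glue x y | x <- s1, y <- s2]; split.
  move=> _ /allpairsP[[x y] /= [/s1W[xW xd] /s2W[yW yd] ->]];
    rewrite /= setUSS //.
  split=> //; rewrite cardsU;
    suff -> : x.2 :&: y.2 = set0 by rewrite cards0 subn0 leq_add.
  apply: disjoint_setI0; apply: disjointWl xW _; exact: disjointWr yW _.
move=> a; transitivity
  (count (fun x => box W1 x a) s1 * count (fun y => box W2 y a) s2)%N.
  have glueE x y : x \in s1 -> y \in s2 ->
      box (W1 :|: W2) (glue x y) a = box W1 x a && box W2 y a.
    move=> /s1W[xW _] /s2W[yW _]; apply/boxP/andP => [H|[/boxP H1 /boxP H2] i].
      split; apply/boxP => i iW; have := H i;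
        rewrite !inE iW ?orbT /= mnmE => /(_ isT).
        have -> : i \in y.2 = false.
          by apply: contraTF iW => /(subsetP yW) iW2;
            rewrite (disjointFl W12 iW2).
        by rewrite orbF iW.
      have -> : i \in x.2 = false.
        by apply: contraTF iW => /(subsetP xW) iW1;
          rewrite (disjointFr W12 iW1).
      by rewrite /= (disjointFl W12 iW).
    rewrite !inE mnmE; have [iW _|iW /= iW2] := boolP (i \in W1).
      have -> : i \in y.2 = false.
        by apply: contraTF iW => /(subsetP yW) iW2;
          rewrite (disjointFl W12 iW2).
      by rewrite orbF; apply: H1.
    have -> : i \in x.2 = false by apply: contraNF iW => /(subsetP xW).
    exact: H2.
  elim: s1 {s1X s1W} (s1W) glueE => [//|x s1 IH] xs1W glueE.
  rewrite /= count_cat IH; last 2 first.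
  - by move=> bZ bZs; apply: xs1W; rewrite inE bZs orbT.
  - by move=> x' y' x's; apply: glueE; rewrite inE x's orbT.
  rewrite mulnDl; congr (_ + _)%N; rewrite count_map.
  rewrite (eq_in_count (a2 := fun y => box W1 x a && box W2 y a)); last first.
    by move=> y ys; rewrite /= glueE ?mem_head.
  by case: (box W1 x a); rewrite ?mul1n ?count_pred0.
by rewrite s1X s2Y; case: (X a); case: (Y a).
Qed.

(** A set closed under increasing one coordinate i, and insensitive to
    increasing any other coordinate beyond N, is cut by fixing the truncations
    at N of the other coordinates. Each piece is a single box: i is free,
    starting at the least possible value, as are all coordinates truncated to
    N. *)
Lemma box_partition_ray W (i : 'I_n) N X : i \in W ->
  (forall a, X a -> X (a + U_(i))%MM) ->
  (forall a b, a i = b i -> {in W, forall j, minn (a j) N = minn (b j) N} ->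
     X a = X b) ->
  box_partition W 1 X.
Proof.
move=> iW Xup Xcap.
have Xcap' a b : a i = b i ->
  {in W :\ i, forall j, minn (a j) N = minn (b j) N} ->
    X a = X b.
  move=> abi ab; apply: Xcap => // j jW.
  by have [->|ji] := eqVneq j i; [rewrite abi | apply: ab; rewrite !inE ji].
have XupD a b : (b i <= a i)%N ->
  {in W :\ i, forall j, minn (a j) N = minn (b j) N} ->
    X b -> X a.
  move=> abi ab; rewrite (Xcap' a (b + U_(i) *+ (a i - b i))%MM).
  - move=> Xb; elim: (_ - _)%N => [|t IH]; first by rewrite mulm0n addm0.
    by rewrite mulmS [(U_(i) + _)%MM]addmC addmA; apply: Xup.
  - by rewrite mnmDE mulmnE mnm1E eqxx mul1n subnKC.
  move=> j jW; rewrite (ab j jW) mnmDE mulmnE mnm1E eq_sym.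
  by move: jW; rewrite !inE => /andP[/negPf -> _]; rewrite mul0n addn0.
pose cap a : {ffun 'I_n -> 'I_N.+1} :=
  [ffun j => if j \in W :\ i then inord (minn (a j) N) else ord0].
have capE a j : j \in W :\ i -> cap a j = minn (a j) N :> nat.
  by move=> jW; rewrite ffunE jW inordK // ltnS geq_minr.
apply: (@box_partition_sum _ (index_enum {ffun 'I_n -> 'I_N.+1}) _ _
          (fun g a => X a && (g == cap a))); last first.
  move=> a; rewrite (bigD1 (cap a)) //= eqxx andbT big1 ?addn0 // =>
    g /negPf ->.
  by rewrite andbF.
move=> g _; have [[a0 /andP[Xa0 /eqP gE]]|noX] :=
  pselect (exists a, X a && (g == cap a)); last first.
  exists [::]; split=> // a /=; case E : (_ && _) => //.
  by case: noX; exists a.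
pose pt (t : nat) : mon := [multinom (if j == i then t else g j : nat) | j < n].
have pt_i t : pt t i = t by rewrite mnmE eqxx.
have pt_j t j : j \in W :\ i -> pt t j = g j by rewrite mnmE !inE =>
  /andP[/negPf ->].
have ptX t a : g = cap a ->
  {in W :\ i, forall j, minn (a j) N = minn (pt t j) N}.
  by move=> gc j jW; rewrite pt_j // gc capE // -minnA minnn.
have ex : exists t, X (pt t).
  by exists (a0 i); rewrite -(Xcap' a0) //; apply: ptX.
have [t0 Xt0 t0min] := ex_minnP ex.
exists [:: (pt t0, i |: [set j in W | g j == N :> nat])]; split=> [bZ|a].
  rewrite inE => /eqP -> /=; split; last by apply/card_gt0P; exists i;
    rewrite !inE eqxx.
  by rewrite subUset sub1set iW; apply/subsetP => j; rewrite inE => /andP[].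
rewrite /= addn0; congr (nat_of_bool _);
  apply/boxP/andP => [H|[Xa /eqP ga] j jW].
  have H_i : (t0 <= a i)%N by have := H i iW; rewrite !inE eqxx /= pt_i.
  have aE j : j \in W :\ i -> minn (a j) N = g j.
    move=> jWi; move: (jWi); rewrite !inE => /andP[ji jW].
    have := H j jW; rewrite !inE (negPf ji) jW /= pt_j //.
    have gN : (g j <= N)%N by rewrite -ltnS ltn_ord.
    case: eqP => [gj|_ /eqP ->]; last exact/minn_idPl.
    by rewrite gj => /minn_idPr.
  have ga : g = cap a.
    apply/ffunP => j; apply: val_inj => /=.
    have [jW|jW] := boolP (j \in W :\ i); first by rewrite capE // aE.
    by rewrite gE !ffunE (negPf jW).
  split; last by rewrite {1}ga.
  by apply: XupD Xt0; rewrite ?pt_i //; apply: ptX.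
rewrite !inE /=; have [->|ji] := eqVneq j i.
  rewrite pt_i; apply: t0min; rewrite -(Xcap' a) //.
  exact: ptX.
have jWi : j \in W :\ i by rewrite !inE ji.
rewrite jW /= pt_j // ga capE //; case: eqP => ?; lia.
Qed.

(** Suppose that each point of X has an escape direction along which it stays
    in X, and that moving along an escape direction keeps it an escape
    direction without creating new ones. Classifying the points by their least
    escape direction splits X into sets closed upward in that direction. *)
Lemma box_partition_escape W N X (esc : 'I_n -> pred mon) :
  (forall a, X a -> exists2 i, i \in W & esc i a) ->
  (forall a i, X a -> esc i a -> X (a + U_(i))%MM) ->
  (forall a i, esc i a -> esc i (a + U_(i))%MM) ->
  (forall a i j, esc i a -> esc j (a + U_(i))%MM -> esc j a) ->
  (forall a b, {in W, forall j, minn (a j) N = minn (b j) N} ->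
     X a = X b /\ forall i, esc i a = esc i b) ->
  box_partition W 1 X.
Proof.
move=> escE Xesc esc_up esc_dn cap.
pose X' i a := [&& X a, esc i a & [forall j in W, (j < i)%N ==> ~~ esc j a]].
apply: (@box_partition_sum _ (enum W) _ _ X') => [i|a].
  rewrite mem_enum => iW;
    apply: (box_partition_ray (N := N) iW) => [a|a b _ ab].
    case/and3P => Xa ia first_i; apply/and3P; split;
      [exact: Xesc|exact: esc_up|].
    apply/forall_inP => j jW; apply/implyP => ji.
    apply: contra (implyP (forall_inP first_i j jW) ji); exact: esc_dn.
  have [XE eE] := cap a b ab; rewrite /X' XE eE; congr [&& _, _ & _].
  by apply: eq_forallb => j; rewrite eE.
rewrite big_enum /=; case Xa : (X a); last first.
  by rewrite big1 // => i _; rewrite /X' Xa.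
have [i0 i0W i0a] := escE a Xa.
have := @arg_minnP _ i0 (fun i => (i \in W) && esc i a) (fun i => i : nat).
rewrite i0W => /(_ i0a); case=> i /andP[iW ia] i_min.
rewrite (bigD1 i) //= big1 => [|j /andP[jW ji]].
  rewrite /X' Xa ia; case: forall_inP => // -[] j jW; apply/implyP.
  by apply: contraTN => ja; rewrite -leqNgt; apply: i_min; rewrite jW.
apply/eqP; rewrite eqb0; apply: contra ji => /and3P[_ ja /forall_inP/(_ i iW)].
rewrite ia implybF -leqNgt => ij; rewrite -val_eqE eqn_leq ij /=.
by apply: i_min; rewrite jW.
Qed.

End BoxPartitions.

(** * From boxes to Stanley decompositions *)

Section StanleyDepthLowerBound.
Variables (K : fieldType) (n : nat) (P : pred 'X_{1..n}).
Local Notation S := {mpoly K[n]}.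

Lemma stanley_space_box (b : 'X_{1..n}) (Z : {set 'I_n}) (f : S) :
  stanley_space 'X_[b] Z f <-> supp_in (box [set: 'I_n] (b, Z)) f.
Proof.
split=> [[v vZ ->]|fP].
  have bX : supp_in (fun m => m == b) ('X_[b] : S) by apply: supp_inX.
  have vQ : supp_in (fun m => [forall i, (m i != 0%N) ==> (i \in Z)]) v.
    by move=> m mv; apply/forallP => i; apply/implyP/vZ.
  apply: (supp_inM _ bX vQ) => _ m /eqP -> /forallP mZ; apply/boxP => i _ /=.
  rewrite mnmDE; case: ifP => iZ; first exact: leq_addr.
  by have := mZ i; rewrite iZ implybF negbK => /eqP ->; rewrite addn0.
exists (\sum_(m <- msupp f) f@_m *: 'X_[m - b]).
  suff vQ : supp_in (fun m => [forall i, (m i != 0%N) ==> (i \in Z)])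
      (\sum_(m <- msupp f) f@_m *: 'X_[m - b] : S).
    by move=> m /vQ /forallP mZ i; apply/implyP.
  rewrite big_seq; apply: supp_in_sum => m /fP /boxP mb m' /msuppZ_le.
  rewrite msuppX inE => /eqP ->; apply/forallP => i; apply/implyP.
  rewrite mnmBE; have := mb i; rewrite inE /= => /(_ isT).
  by case: ifP => // _ /eqP ->; rewrite subnn.
rewrite {1}[f]mpolyE mulr_sumr big_seq [RHS]big_seq.
apply: eq_bigr => m /fP /boxP mb; rewrite -scalerAr -mpolyXD;
  congr (_ *: 'X_[_]).
rewrite addmC submK //; apply/mnm_lepP => i; have := mb i; rewrite inE /=.
by case: ifP => _ /(_ isT) // /eqP ->.
Qed.

(** The Stanley space x^b K[Z] consists of the polynomials supported on the
    box (b, Z), so a partition of P into boxes sorts the terms of a polynomial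
    supported on P. *)
Lemma stanley_decomposition_of_boxes (s : seq ('X_{1..n} * {set 'I_n})) :
  (forall a, count (fun bZ => box [set: 'I_n] bZ a) s = P a) ->
  let bZ i := nth (0%MM, set0) s i in
  stanley_decomposition (@supp_in K n P)
    (fun i : 'I_(size s) => 'X_[(bZ i).1]) (fun i => (bZ i).2).
Proof.
move=> sP bZ; pose B (i : 'I_(size s)) a := box [set: 'I_n] (bZ i) a.
have sumB a : (\sum_i B i a = P a)%N.
  rewrite -sP -sum1_count [RHS]big_mkcond (big_nth (0%MM, set0)) big_mkord.
  by apply: eq_bigr => i _; rewrite /B; case: (box _ _ _).
have BP i a : B i a -> P a.
  by move=> Bia; have := sumB a; rewrite (bigD1 i) //= Bia; case: (P a).
have Buniq i j a : B i a -> B j a -> i = j.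
  move=> Bi Bj; apply/eqP; apply: contraT => ij; have := sumB a.
  rewrite (bigD1 i) //= (bigD1 j) 1?eq_sym //= Bi Bj; case: (P a); lia.
have spaceE (i : 'I_(size s)) (f : S) :
  stanley_space 'X_[(bZ i).1] (bZ i).2 f <-> supp_in (B i) f.
  by rewrite /B; case: (bZ i) => b Z; apply: stanley_space_box.
split=> [i|f|g gB g0 i].
- split; last first.
  + by move=> v _ /eqP; rewrite mulf_eq0 => /orP[|/eqP //];
    rewrite -msupp_eq0 msuppX.
  + by exists 1, (bZ i).1; rewrite scale1r.
  apply/supp_inX/(BP i)/boxP => j _; by case: ifP.
- split=> [fP|[g [gB ->]]]; last first.
    by apply: supp_in_sum => i _ m m_g; apply: (BP i); move/spaceE: (gB i);
      apply.
  exists (fun i => \sum_(m <- msupp f | B i m) f@_m *: 'X_[m]); split=> [i|].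
    apply/spaceE; apply: supp_in_sum => m Bm m' /msuppZ_le.
    by rewrite msuppX inE => /eqP ->.
  rewrite (exchange_big_dep predT) //= {1}[f]mpolyE big_seq [RHS]big_seq.
  apply: eq_bigr => m /fP Pm.
  by rewrite sumr_const -sum1_card big_mkcond /= sumB Pm.
apply/mpolyP => m; rewrite mcoeff0; apply/eqP; rewrite mcoeff_eq0;
  apply/negP => mg.
have Bm : B i m by move/spaceE: (gB i); apply.
have : (\sum_j g j)@_m = 0 by rewrite g0 mcoeff0.
rewrite raddf_sum (bigD1 i) //= big1 ?addr0 => [|j ji].
  by move/eqP; rewrite mcoeff_eq0 mg.
apply/eqP; rewrite mcoeff_eq0; apply: contra ji => mgj.
by apply/eqP/(Buniq _ _ m) => //; move/spaceE: (gB j); apply.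
Qed.

Lemma enat_le_sdepth_decomposition d r (Z : 'I_r -> {set 'I_n}) :
  (forall i, (d <= #|Z i|)%N) -> enat_le (Fin d) (sdepth_decomposition Z).
Proof.
move=> dZ; rewrite /sdepth_decomposition.
elim/big_ind: _ => [//|[x|] [y|] //= dx dy|i _]; last exact: dZ.
by rewrite leq_min dx dy.
Qed.

Lemma enat_le_trans a b c : enat_le a b -> enat_le b c -> enat_le a c.
Proof. by case: a b c => [a|] [b|] [c|] //=; apply: leq_trans. Qed.

Lemma enat_le_sup (Q : enat -> Prop) a : Q a -> enat_le a (enat_sup Q).
Proof.
rewrite /enat_sup; case: pselect => [bounded|_]; last by case: a.
by case: ex_minnP => b /asboolP Qb _; apply: Qb.
Qed.

Lemma enat_sup_le (Q : enat -> Prop) b :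
  (forall a, Q a -> enat_le a (Fin b)) -> enat_le (enat_sup Q) (Fin b).
Proof.
move=> Qb; rewrite /enat_sup; case: pselect => [bounded|]; last first.
  by case; exists b; apply/asboolP.
by case: ex_minnP => m _; apply; apply/asboolP.
Qed.

Lemma sdepth_ge_of_box_partition d :
  box_partition [set: 'I_n] d P -> enat_le (Fin d) (sdepth (@supp_in K n P)).
Proof.
case=> s [sd sP]; have dec := stanley_decomposition_of_boxes sP.
apply: enat_le_trans (enat_le_sup _); last first.
  by eexists _, _, _; split; [exact: dec|reflexivity].
by apply: enat_le_sdepth_decomposition => i;
  have [] := sd _ (mem_nth (0%MM, set0) (ltn_ord i)).
Qed.

End StanleyDepthLowerBound.

(** * Minimum weights of covers and their level sets *)

Section CoverNumber.
Variables (n : nat) (e : rel 'I_n).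
Local Notation cover := {ffun 'I_n -> 'I_3}.
Implicit Types (V W : {set 'I_n}) (a b : 'X_{1..n}) (c : cover).

Definition optimal_cover W a : cover :=
  [arg min_(c < [ffun=> ord_max] | half_cover e c) weight W c a].

Definition cover_number W a : nat := weight W (optimal_cover W a) a.

Lemma optimal_coverP W a : half_cover e (optimal_cover W a) /\
  forall c, half_cover e c -> (cover_number W a <= weight W c a)%N.
Proof.
rewrite /cover_number /optimal_cover; case: arg_minnP => //.
by apply/half_coverP => i j _; rewrite !ffunE.
Qed.

(** If some coordinate of positive cover value reaches N, both weights are at
    least N; otherwise all coordinates that matter are below N and agree. *)
Lemma cap_weight N W c a b : {in W, forall j, minn (a j) N = minn (b j) N} ->
  minn N (weight W c a) = minn N (weight W c b).
Proof.
move=> ab; have [/existsP[j /and3P[jW cj aj]]|small] :=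
  boolP [exists j, [&& j \in W, 0 < c j & N <= a j]]%N.
  have big (d : 'X_{1..n}) : (N <= d j)%N -> minn N (weight W c d) = N.
    move=> dj; apply/minn_idPl/(leq_trans dj); rewrite /weight (bigD1 j) //=.
    by apply: leq_trans (leq_addr _ _); apply: leq_pmull.
  by rewrite !big //; have := ab j jW; lia.
congr minn; apply: eq_bigr => j jW.
move/existsPn: small => /(_ j); rewrite jW /= negb_and -leqNgt -ltnNge.
case: (posnP (c j)) => [-> //|cj] /=; rewrite leqNgt cj /= => aj.
by congr (_ * _)%N; have := ab j jW; lia.
Qed.

Lemma cap_cover_number N W a b :
  {in W, forall j, minn (a j) N = minn (b j) N} ->
  minn N (cover_number W a) = minn N (cover_number W b).
Proof.
have le a' b' : {in W, forall j, minn (a' j) N = minn (b' j) N} ->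
    (minn N (cover_number W a') <= minn N (cover_number W b'))%N.
  move=> ab; rewrite -[X in (_ <= X)%N](cap_weight _ ab).
  have [covb _] := optimal_coverP W b';
    have [_ /(_ _ covb)] := optimal_coverP W a'.
  lia.
by move=> ab; apply/eqP; rewrite eqn_leq !le // => j jW; rewrite ab.
Qed.

Lemma weight_le_add W c a i : (weight W c a <= weight W c (a + U_(i))%MM)%N.
Proof. by rewrite weightD leq_addr. Qed.

Lemma cover_number_le_add W a i :
  (cover_number W a <= cover_number W (a + U_(i))%MM)%N.
Proof.
have [cov _] := optimal_coverP W (a + U_(i))%MM.
have [_ /(_ _ cov) le] := optimal_coverP W a.
exact: leq_trans le (weight_le_add _ _ _ _).
Qed.

(** Direction i escapes at a if some optimal cover vanishes at i: then
    increasing coordinate i does not increase the minimum weight. All weights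
    are truncated at N so that the level sets are described by finitely many
    data. *)
Definition escapes N W i a : bool :=
  [exists c, [&& half_cover e c, c i == 0%N :> nat &
                 minn N (weight W c a) == minn N (cover_number W a)]].

Lemma weight_add0 W c a i :
  c i = 0%N :> nat -> weight W c (a + U_(i))%MM = weight W c a.
Proof. by move=> ci; rewrite weightD weight1 ci; case: ifP; rewrite addn0. Qed.

Lemma escapes_cover_number N W i a : escapes N W i a ->
  minn N (cover_number W (a + U_(i))%MM) = minn N (cover_number W a).
Proof.
case/existsP => c /and3P[cov /eqP ci /eqP cE].
have [_ /(_ _ cov)] := optimal_coverP W (a + U_(i))%MM.
by rewrite weight_add0 //; have := cover_number_le_add W a i; lia.
Qed.

Lemma escapes_add N W i a : escapes N W i a -> escapes N W i (a + U_(i))%MM.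
Proof.
move=> ia; have E := escapes_cover_number ia.
case/existsP: ia => c /and3P[cov /eqP ci /eqP cE].
by apply/existsP; exists c; rewrite cov ci eqxx weight_add0 // E cE /=.
Qed.

Lemma escapes_of_add N W i j a :
  escapes N W i a -> escapes N W j (a + U_(i))%MM -> escapes N W j a.
Proof.
move=> /escapes_cover_number E /existsP[c /and3P[cov cj /eqP cE]].
apply/existsP; exists c; rewrite cov cj eqn_leq /=; apply/andP; split.
  by rewrite -E -cE; have := weight_le_add W c a i; lia.
by have [_ /(_ _ cov)] := optimal_coverP W a; lia.
Qed.

Lemma cap_escapes N W i a b : {in W, forall j, minn (a j) N = minn (b j) N} ->
  escapes N W i a = escapes N W i b.
Proof.
move=> ab; apply: eq_existsb => c.
by rewrite (cap_weight _ ab) (cap_cover_number ab).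
Qed.

Definition edge_closed W : Prop := forall i j, e i j -> (i \in W) = (j \in W).

(** If an optimal cover has no zero on W, it has value at least 1 everywhere
    on W, so its weight is at least the mean of the weights of the two covers
    equal to 2 on one side of the bipartition and 0 on the other. One of these
    is then optimal too, and it vanishes on a whole side. When W spans no edge
    a side may be empty, but then the zero cover is available. *)
Lemma bipartite_escape N W a : W != set0 -> edge_closed W -> bipartite_on e W ->
  exists2 i, i \in W & escapes N W i a.
Proof.
move=> /set0Pn[w wW] Wcl /existsP[A /forall_inP bipA].
have bip i j : i \in W -> j \in W -> e i j -> (i \in A) != (j \in A).
  by move=> iW jW eij; have /forall_inP/(_ j jW)/implyP/(_ eij) := bipA i iW.
have [cov opt] := optimal_coverP W a.
have escape_of c i : half_cover e c -> c i = 0%N :> nat ->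
    (weight W c a <= cover_number W a)%N -> escapes N W i a.
  move=> covc ci le; apply/existsP; exists c; rewrite covc ci eqxx /=.
  by apply/eqP; have := opt c covc; lia.
pose inner (f : 'I_n -> bool) : cover :=
  [ffun i => if i \in W then if f i then ord_max else ord0 else ord_max].
have innerE f i : inner f i = (if i \in W then (f i).*2 else 2)%N :> nat.
  by rewrite ffunE; case: (i \in W); case: (f i).
have inner_cov f : (forall i j, i \in W -> j \in W -> e i j -> f i || f j) ->
    half_cover e (inner f).
  move=> fcov; apply/half_coverP => i j eij; rewrite !innerE (Wcl i j eij).
  case: ifP => // jW; have iW : i \in W by rewrite (Wcl i j eij).
  by have := fcov i j iW jW eij; case: (f i); case: (f j).
have [/existsP[x /existsP[y /and3P[xW yW exy]]]|noedge] :=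
    boolP [exists x, exists y, [&& x \in W, y \in W & e x y]]; last first.
  exists w => //; apply: (escape_of (inner xpred0)).
  - apply: inner_cov => i j iW jW eij; case/negP: noedge.
    by apply/existsP; exists i; apply/existsP; exists j; rewrite iW jW.
  - by rewrite innerE wW.
  by rewrite /weight big1 // => i iW; rewrite innerE iW.
have [/existsP[z /andP[zW /eqP z0]]|pos] :=
    boolP [exists z, (z \in W) && (optimal_cover W a z == 0%N :> nat)].
  by exists z => //; apply: (escape_of _ _ cov z0).
(* the two one-sided covers add up to the constant cover 2 *)
have sum_le : (weight W (inner (mem A)) a + weight W
  (inner (fun i => i \notin A)) a
    <= (cover_number W a).*2)%N.
  rewrite /cover_number -mul2n /weight big_distrr -big_split /=.
  apply: leq_sum => i iW; rewrite !innerE iW /=.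
  move/existsPn: pos => /(_ i); rewrite iW /= => ?.
  have -> : ((i \in A).*2 * a i + (i \notin A).*2 * a i = 2 * a i)%N.
    by case: (i \in A); rewrite /= !mul0n ?addn0.
  by rewrite leq_mul2l /=; apply: leq_pmull; rewrite lt0n.
have xy := bip _ _ xW yW exy.
have [z1 z1W z1A] : exists2 z, z \in W & z \in A.
  by case xA: (x \in A) xy => yA;
    [exists x | exists y => //; move: yA; case: (_ \in _)].
have [z2 z2W z2A] : exists2 z, z \in W & z \notin A.
  by case xA: (x \in A) xy => yA; [exists y | exists x; rewrite ?xA].
have [le|lt] := leqP (weight W (inner (mem A)) a) (cover_number W a).
  exists z2 => //; apply: (escape_of (inner (mem A))) => //.
    apply: inner_cov => i j iW jW /(bip _ _ iW jW) /=.
    by case: (_ \in _); case: (_ \in _).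
  by rewrite innerE z2W /= (negPf z2A).
exists z1 => //; apply: (escape_of (inner (fun i => i \notin A))).
- apply: inner_cov => i j iW jW /(bip _ _ iW jW) /=.
  by case: (_ \in _); case: (_ \in _).
- by rewrite innerE z1W z1A.
by move: sum_le lt; clear; lia.
Qed.

Lemma level_box_partition N W t : W != set0 -> edge_closed W ->
  bipartite_on e W ->
  box_partition W 1 (fun a => minn N (cover_number W a) == t).
Proof.
move=> W0 Wcl Wbip; apply: (box_partition_escape (N := N) (esc := escapes N W)).
- by move=> a _; apply: bipartite_escape.
- by move=> a i /eqP aE ia; rewrite escapes_cover_number // aE.
- by move=> a i; apply: escapes_add.
- by move=> a i j; apply: escapes_of_add.
move=> a b ab; rewrite (cap_cover_number ab); split=> // i.
exact: cap_escapes.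
Qed.

(** Splitting along the values of the minimum weight on one block turns a
    threshold set into a disjoint union of products of a level set with a
    threshold set for the remaining blocks. Every block contributes a free
    direction; so does V, where the threshold set is closed upward and any
    vertex v of V is a free direction. *)
Lemma threshold_box_partition N V (ls : seq {set 'I_n}) t : V != set0 ->
  (forall W, W \in ls -> [/\ W != set0, edge_closed W & bipartite_on e W]) ->
  (forall i, (count (fun W => i \in W) ls <= (i \notin V))%N) ->
  box_partition (foldr (fun W U => W :|: U) V ls) (size ls).+1
    (fun a => t <= minn N (cover_number V a) +
                   \sum_(W <- ls) minn N (cover_number W a))%N.
Proof.
move=> /set0Pn[v vV]; elim: ls t => [|W ls IH] t lsP dis.
  apply: (@eq_box_partition _ _ _ (fun a => t <= minn N (cover_number V a))%N).
    by move=> a; rewrite big_nil addn0.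
  apply: (box_partition_ray (N := N) vV) => [a|a b _ ab].
    by have := cover_number_le_add V a v; lia.
  by rewrite (cap_cover_number ab).
have [W0 Wcl Wbip] := lsP W (mem_head _ _).
have dis' i : (count (fun W => i \in W) ls <= (i \notin V))%N.
  by have /= := dis i; lia.
have WU : [disjoint W & foldr (fun W U => W :|: U) V ls].
  apply/pred0P => i /=; apply/negbTE/negP => /andP[iW].
  have := dis i; rewrite /= iW; case iV : (i \in V);
    rewrite add1n //= ltnS => cnt.
  have {cnt} : ~~ has (fun W => i \in W) ls by rewrite has_count -leqNgt;
    exact: cnt.
  elim: (ls) => [|U l IHl] /=; first by rewrite iV.
  by rewrite negb_or inE => /andP[/negPf ->] /=.
apply: (@box_partition_sum _ _ (iota 0 N.+1) _ _
  (fun j a => (minn N (cover_number W a) == j) &&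
     (t - j <= minn N (cover_number V a) +
               \sum_(W <- ls) minn N (cover_number W a)))%N) => [j _|a].
  apply: (box_partition_prod (d1 := 1) WU); first exact: level_box_partition.
  by apply: IH => // U Uls; apply: lsP; rewrite inE Uls orbT.
have leN : (minn N (cover_number W a) < N.+1)%N by rewrite ltnS geq_minl.
rewrite -/(index_iota 0 N.+1) big_mkord (bigD1 (Ordinal leN)) //= eqxx.
rewrite [X in (_ + X)%N]big1 => [|j jN].
  by rewrite addn0 big_cons leq_subLR addnCA.
by case: eqP => //= jE; case/eqP: jN; apply: val_inj.
Qed.

(** Optimal covers on disjoint unions of components glue to a global cover, so
    minimum weights add up. Truncating them at 2k does not affect the
    comparison of their sum with 2k. *)
Lemma heavy_blocks k V (ls : seq {set 'I_n}) a :
  (forall W, W \in ls -> edge_closed W) ->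
  (forall i, count (fun W => i \in W) ls = (i \notin V) :> nat) ->
  heavy e k a = (2 * k <= minn (2 * k) (cover_number V a) +
    \sum_(W <- ls) minn (2 * k) (cover_number W a))%N.
Proof.
move=> lsP cnt.
have weightE c : weight [set: 'I_n] c a =
    (weight V c a + \sum_(W <- ls) weight W c a)%N.
  rewrite /weight; under [X in (_ + X)%N]eq_bigr do rewrite big_mkcond /=.
  rewrite exchange_big /= [X in (X + _)%N]big_mkcond -big_split /=.
  rewrite big_mkcond; apply: eq_bigr => i _; rewrite inE.
  rewrite -big_mkcond big_const_seq cnt; case: (i \in V) => /=;
    first by rewrite addn0.
  by rewrite addn0.
have optcov W c : half_cover e c -> (cover_number W a <= weight W c a)%N.
  by have [_] := optimal_coverP W a; apply.
apply/heavyP/idP => [hv|le c cov]; last first.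
  rewrite weightE; apply: leq_trans le _; apply: leq_add.
    by rewrite geq_min optcov ?orbT.
  by apply: leq_sum => W _; rewrite geq_min optcov ?orbT.
pose blk (i : 'I_n) := head V [seq W : {set 'I_n} <- ls | i \in W].
pose c : cover := [ffun i => optimal_cover (blk i) a i].
have blkV i : i \in V -> blk i = V.
  move=> iV; rewrite /blk; have := cnt i; rewrite iV -size_filter.
  by move/size0nil ->.
have blkW W i : W \in ls -> i \in W -> blk i = W.
  move=> Wls iW; have :
    W \in [seq W : {set 'I_n} <- ls | i \in W] by rewrite mem_filter iW.
  have : (size [seq W : {set 'I_n} <- ls | i \in W] <= 1)%N.
    by rewrite size_filter cnt; case: (_ \in _).
  rewrite /blk; case: [seq _ <- _ | _] => [//|U [|//]] _.
  by rewrite inE => /eqP.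
have c_cov : half_cover e c.
  apply/half_coverP => i j eij; rewrite !ffunE.
  suff -> : blk j = blk i.
    have [/half_coverP cov _] := optimal_coverP (blk i) a; exact: cov.
  rewrite /blk; congr head; apply: eq_in_filter => W Wls.
  by rewrite (lsP W Wls i j eij).
have := hv c c_cov; rewrite weightE.
have -> : weight V c a = cover_number V a.
  by apply: eq_bigr => i iV; rewrite ffunE blkV.
rewrite (eq_big_seq (fun W => cover_number W a)); last first.
  by move=> W Wls; apply: eq_bigr => i iW; rewrite ffunE (blkW W).
elim: (ls) (cover_number V a) => [|W l IH] x; first by rewrite !big_nil; lia.
rewrite !big_cons => H; have := IH (x + cover_number W a)%N.
by rewrite -addnA => /(_ H); lia.
Qed.

End CoverNumber.

(** * Ordered Koszul cochains bound the length of regular sequences *)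

Section OrderedKoszul.
Variables (K : fieldType) (n : nat).
Local Notation S := {mpoly K[n]}.
Local Notation cochain := (seq 'I_n -> S).
Implicit Types (theta eta : 'I_n -> S) (z y : cochain) (s : seq 'I_n).

(** Exterior product of a 1-form with a cochain, where cochains are arbitrary
    functions on lists of variables. No alternation is imposed, which gives
    the recursion on the list; the contraction by a variable i is simply [fun
    t => z (i :: t)]. *)
Fixpoint wedge theta z s : S :=
  if s is i :: s' then theta i * z s' - wedge theta (fun t => z (i :: t)) s'
  else 0.

Definition koszul z s : S := wedge (fun i => 'X_i) z s.

Lemma eq_wedge theta z z' s :
  (forall t, (size t).+1 = size s -> z t = z' t) ->
  wedge theta z s = wedge theta z' s.
Proof.
elim: s z z' => [//|i s IH] z z' zz' /=; rewrite zz' //; congr (_ - _).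
by apply: IH => t tE; apply: zz'; rewrite /= tE.
Qed.

Lemma wedge_lin theta a z y s :
  wedge theta (fun t => a * z t + y t) s
    = a * wedge theta z s + wedge theta y s.
Proof.
by elim: s z y => [|i s IH] z y /=; [rewrite mulr0 addr0 | rewrite IH; ring].
Qed.

Lemma wedge0 theta s : wedge theta (fun=> 0) s = 0.
Proof. by elim: s => //= i s ->; rewrite mulr0 subr0. Qed.

Lemma wedge_eq0 theta z s :
  (forall t, (size t).+1 = size s -> z t = 0) -> wedge theta z s = 0.
Proof. by move=> z0; rewrite -(wedge0 theta s); apply: eq_wedge. Qed.

Lemma wedgeZ theta a z s :
  wedge theta (fun t => a * z t) s = a * wedge theta z s.
Proof.
rewrite -[RHS]addr0 -(wedge0 theta s) -wedge_lin.
by apply: eq_wedge => t _; rewrite addr0.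
Qed.

Lemma wedgeB theta z y s :
  wedge theta (fun t => z t - y t) s = wedge theta z s - wedge theta y s.
Proof.
rewrite [RHS]addrC -mulN1r -wedge_lin.
by apply: eq_wedge => t _; rewrite mulN1r addrC.
Qed.

Lemma wedge_linl a theta eta z s :
  wedge (fun i => a * theta i + eta i) z s
    = a * wedge theta z s + wedge eta z s.
Proof. by elim: s z => [|i s IH] z /=;
  [rewrite mulr0 addr0 | rewrite IH; ring]. Qed.

Lemma wedge0l z s : wedge (fun=> 0) z s = 0.
Proof. by elim: s z => //= i s IH z; rewrite mul0r IH subrr. Qed.

(** Both sides expand by the Leibniz rule with respect to contraction by the
    head of the list. *)
Lemma wedgeC theta eta z s :
  wedge theta (wedge eta z) s = - wedge eta (wedge theta z) s.
Proof.
elim: s z => [|i s IH] z /=; first by rewrite oppr0.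
by rewrite !wedgeB !wedgeZ IH; ring.
Qed.

Lemma wedge_sq theta z s : wedge theta (wedge theta z) s = 0.
Proof. by elim: s z => //= i s IH z; rewrite wedgeB wedgeZ IH; ring. Qed.

Definition submodule (N : S -> Prop) : Prop :=
  [/\ N 0, forall f g, N f -> N g -> N (f + g) & forall c f, N f -> N (c * f)].

Lemma submoduleB N f g : submodule N -> N f -> N g -> N (f - g).
Proof. by move=> [_ ND NM] Nf Ng; rewrite -mulN1r; apply/ND/NM. Qed.

Lemma wedge_in N theta z s : submodule N ->
  (forall t, (size t).+1 = size s -> N (z t)) -> N (wedge theta z s).
Proof.
move=> Nmod; have [N0 _ NM] := Nmod.
elim: s z => [//|i s IH] z zN /=; apply: submoduleB => //; first exact/NM/zN.
by apply: IH => t tE; apply: zN; rewrite /= tE.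
Qed.

Lemma wedge_inl N theta z s : submodule N ->
  (forall i, N (theta i)) -> N (wedge theta z s).
Proof.
move=> Nmod thN; have [N0 _ NM] := Nmod.
elim: s z => [//|i s IH] z /=; apply: submoduleB => //.
by rewrite mulrC; apply: NM.
Qed.

(** There is a non-zero class of degree d in the Koszul cohomology of the
    variables with values in M / N. *)
Definition koszul_class (M N : S -> Prop) (d : nat) : Prop :=
  exists z, [/\ forall s, size s = d -> M (z s),
                forall s, size s = d.+1 -> N (koszul z s) &
    forall y, (forall s, (size s).+1 = d -> M (y s)) ->
              (forall s, size s = d -> N (z s - koszul y s)) -> False].

(** The variable x_i acts as zero on Koszul cohomology, contraction by i being
    a homotopy; the defining recursion of [wedge] is this homotopy formula. By
    linearity every f in the irrelevant ideal acts as zero. *)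
Lemma koszul_homotopy (M N : S -> Prop) z d f :
  submodule M -> submodule N ->
  (forall s, size s = d -> M (z s)) ->
  (forall s, size s = d.+1 -> N (koszul z s)) ->
  irrelevant_ideal f ->
  exists y, (forall s, (size s).+1 = d -> M (y s)) /\
            (forall s, size s = d -> N (f * z s - koszul y s)).
Proof.
move=> [M0 MD MM] [N0 ND NM] zM dzN.
pose Q f := exists y, (forall s, (size s).+1 = d -> M (y s)) /\
                      (forall s, size s = d -> N (f * z s - koszul y s)).
apply: (@ideal_gen_ind _ _ _ Q) => [|g h [y [yM yN]] [y' [yM' yN']]|c _ [i ->]].
- exists (fun=> 0); split=> // s _.
  by rewrite /koszul wedge0 mul0r subrr.
- exists (fun t => 1 * y t + y' t); split=> [s sd|s sd].
    by rewrite mul1r; apply: MD; [apply: yM | apply: yM'].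
  rewrite /koszul wedge_lin -!/(koszul _ _).
  have -> : (g + h) * z s - (1 * koszul y s + koszul y' s) =
    (g * z s - koszul y s) + (h * z s - koszul y' s) by ring.
  by apply: ND; [apply: yN | apply: yN'].
exists (fun t => c * z (i :: t)); split=> [s sd|s sd].
  by apply/MM/zM.
have -> : c * 'X_i * z s - koszul (fun t => c * z (i :: t)) s =
    c * koszul z (i :: s) by rewrite /koszul wedgeZ /=; ring.
by apply/NM/dzN; rewrite /= sd.
Qed.

Definition regular_on (M N : S -> Prop) f : Prop :=
  forall x, M x -> N (f * x) -> N x.

Lemma koszul_class0_not_regular (M N : S -> Prop) f :
  submodule M -> submodule N -> irrelevant_ideal f -> regular_on M N f ->
  ~ koszul_class M N 0.
Proof.
move=> Mmod Nmod f_irr f_reg [z [zM dzN nz]].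
have [y [_ yN]] := koszul_homotopy Mmod Nmod zM dzN f_irr.
apply: (nz (fun=> 0)) => // s /size0nil ->; rewrite subr0.
by apply: f_reg; [apply: zM | have := yN [::] erefl; rewrite subr0].
Qed.

(** This is the connecting map of 0 -> M/N -> M/N -> M/(N + f M) -> 0: since f
    kills the class of z, f z is the coboundary of some y modulo N, and y is a
    cocycle modulo N + f M. If y were a coboundary up to f v, then f (z -
    koszul v) would lie in N, and so would z - koszul v because f is regular. *)
Lemma koszul_class_step (M N N' : S -> Prop) f d :
  submodule M -> submodule N -> irrelevant_ideal f -> regular_on M N f ->
  (forall x, N' x <-> exists u v, [/\ N u, M v & x = u + f * v]) ->
  koszul_class M N d.+1 -> koszul_class M N' d.
Proof.
move=> Mmod Nmod f_irr f_reg N'E [z [zM dzN nz]].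
have [_ MD MM] := Mmod; have [N0 ND NM] := Nmod.
have [y [yM yN]] := koszul_homotopy Mmod Nmod zM dzN f_irr.
exists y; split=> [s sd|s sd|y' y'M y'N]; first by apply: yM; rewrite sd.
  apply/N'E; exists (koszul y s - f * z s), (z s); split; last by ring.
    by rewrite -opprB -mulN1r; apply/NM/yN.
  exact: zM.
have ex s : exists v, size s = d -> M v /\ N (y s - koszul y' s - f * v).
  have [sd|sd] := eqVneq (size s) d; last by exists 0 => /eqP;
    rewrite (negPf sd).
  have /N'E[u [v [uN vM E]]] := y'N s sd.
  by exists v; split=> //; rewrite E addrK.
have [v vP] := choice ex.
apply: (nz v) => [s [/vP[]] //|s sd]; apply: f_reg.
  apply: submoduleB (zM s sd) _ => //; apply: wedge_in => // t;
    rewrite sd => -[/vP[]] //.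
pose w t := y t - koszul y' t - f * v t.
have dw : N (koszul w s).
  by apply: wedge_in => // t; rewrite sd => -[/vP[]].
have dwE : koszul w s = koszul y s - f * koszul v s.
  rewrite /koszul /w wedgeB wedgeZ wedgeB; congr (_ - _).
  by rewrite [X in _ - X]wedge_sq subr0.
have -> : f * (z s - koszul v s) = (f * z s - koszul y s) + koszul w s.
  by rewrite dwE; ring.
by apply: ND => //; apply: yN.
Qed.

Lemma seq_mul_submodule (fs : seq S) (M : S -> Prop) : submodule (seq_mul fs M).
Proof.
split; [exact: ideal_gen0|exact: ideal_genD|exact: ideal_genMl].
Qed.

Lemma seq_mul_rcons (fs : seq S) f (M : S -> Prop) : submodule M ->
  forall x, seq_mul (rcons fs f) M x <->
    exists u v, [/\ seq_mul fs M u, M v & x = u + f * v].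
Proof.
move=> [M0 MD MM] x; have [N0 ND NM] := seq_mul_submodule fs M; split.
  pose Q x := exists u v, [/\ seq_mul fs M u, M v & x = u + f * v].
  apply: (@ideal_gen_ind _ _ _ Q).
  - by exists 0, 0; split=> //; rewrite mulr0 addr0.
  - move=> _ _ [u [v [uN vM ->]]] [u' [v' [uN' vM' ->]]].
    by exists (u + u'), (v + v'); split; [apply: ND|apply: MD|ring].
  move=> c _ [g [m [g_in mM ->]]].
  have QD a b : Q a -> Q b -> Q (a + b).
    move=> [u [v [uN vM ->]]] [u' [v' [uN' vM' ->]]].
    by exists (u + u'), (v + v'); split; [apply: ND|apply: MD|ring].
  rewrite mulrA; move: g_in; rewrite -/(Q _).
  pose R g := Q (c * g * m); apply: (@ideal_gen_ind _ _ _ R) => [|a b|a h].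
  - by rewrite /R mulr0 mul0r; exists 0, 0; split=> //; rewrite mulr0 addr0.
  - by rewrite /R mulrDr mulrDl; apply: QD.
  rewrite mem_rcons inE => /orP[/eqP ->|hfs].
    by exists 0, (c * a * m); split; [exact: N0|exact: MM|ring].
  exists (c * (a * h) * m), 0; split=> //; last by ring.
  apply: ideal_gen_mem; exists (c * (a * h)), m; split=> //.
  by rewrite mulrA; apply/ideal_genMl/ideal_gen_mem.
have sub : forall g, seq_mul fs M g -> seq_mul (rcons fs f) M g.
  apply: ideal_gen_ind; [exact: ideal_gen0|exact: ideal_genD|].
  move=> c _ [g [m [g_in mM ->]]]; apply/ideal_genMl/ideal_gen_mem.
  exists g, m; split=> //; move: g_in.
  apply: ideal_gen_ind; [exact: ideal_gen0|exact: ideal_genD|].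
  move=> a h hfs; apply/ideal_genMl/ideal_gen_mem.
  by rewrite mem_rcons inE hfs orbT.
move=> [u [v [/sub uN vM ->]]]; apply: ideal_genD => //.
apply: ideal_gen_mem; exists f, v; split=> //; apply: ideal_gen_mem.
by rewrite mem_rcons mem_head.
Qed.

(** Dividing by the elements of a regular sequence one by one lowers the
    degree of a non-zero class; in degree 0 it is an element of M/N killed by
    the irrelevant ideal, and no further regular element exists. *)
Lemma regular_sequence_le_koszul (M : S -> Prop) (fs : seq S) d :
  submodule M -> (forall f, f \in fs -> irrelevant_ideal f) ->
  regular_sequence M fs -> koszul_class M (seq_mul [::] M) d ->
  (size fs <= d)%N.
Proof.
move=> Mmod fs_irr [fs_reg _] cls; rewrite leqNgt; apply/negP => d_lt.
have step i : (i <= d)%N -> koszul_class M (seq_mul (take i fs) M) (d - i).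
  elim: i => [|i IH] i_le; first by rewrite take0 subn0.
  have i_lt : (i < size fs)%N by lia.
  rewrite (take_nth 0 i_lt);
    apply: (koszul_class_step Mmod (seq_mul_submodule _ _) (f := fs`_i)).
  - by apply: fs_irr; apply: mem_nth.
  - by move=> x; apply: fs_reg.
  - exact: seq_mul_rcons.
  by rewrite -subSn // subSS; apply: IH; lia.
have := step d (leqnn d); rewrite subnn.
apply: (koszul_class0_not_regular Mmod (seq_mul_submodule _ _) (f := fs`_d)).
- by apply: fs_irr; apply: mem_nth.
by move=> x; apply: fs_reg.
Qed.

End OrderedKoszul.

(** * A Koszul class detected by a cross-polytope *)

Section CrossPolytopeClass.
Variables (K : fieldType) (n : nat).
Local Notation S := {mpoly K[n]}.
Local Notation block := ({set 'I_n} * {set 'I_n})%type.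
Implicit Types (A : {set 'I_n}) (l : block) (ls : seq block) (m :
  'X_{1..n}) (u y : seq 'I_n -> S).

Definition in_block (i : 'I_n) l : bool := i \in l.1 :|: l.2.

(** For a component with sides A and B this 1-form is the sum of the x_j dx_j
    over B. It represents the connecting class of 0 -> R/(A)(B) -> R/(A) +
    R/(B) -> K -> 0, where R is the polynomial ring in the variables of the
    component: namely the differential of the pair (1, 0). For an isolated
    vertex, encoded by an empty A and a singleton B, it is dx_j without the
    factor x_j, the generator of the cohomology of K[x_j]. *)
Definition block_form l (i : 'I_n) : S :=
  if i \in l.2 then if l.1 == set0 then 1 else 'X_i else 0.

Fixpoint block_cochain ls : seq 'I_n -> S :=
  if ls is l :: ls' then wedge (block_form l) (block_cochain ls')
  else fun s => (s == [::])%:R.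

(** Pairing with the fundamental cycle of the cross-polytope whose pairs of
    opposite vertices are chosen one from each side of each block: the
    alternating sum, over the choices gamma of one vertex per pair, of the
    coefficient of u gamma at the exponent m + gamma. An isolated vertex is a
    single choice that does not shift the exponent. *)
Fixpoint cross_pairing ls m u : K :=
  if ls is l :: ls' then
    match [pick i in l.1], [pick i in l.2] with
    | Some i, Some j =>
        cross_pairing ls' (m + U_(j))%MM (fun s => u (j :: s)) -
        cross_pairing ls' (m + U_(i))%MM (fun s => u (i :: s))
    | None, Some j => cross_pairing ls' m (fun s => u (j :: s))
    | _, None => 0
    end
  else (u [::])@_m.

Lemma eq_cross_pairing ls m u u' :
  (forall s, size s = size ls -> u s = u' s) ->
  cross_pairing ls m u = cross_pairing ls m u'.
Proof.
elim: ls m u u' => [|l ls IH] m u u' uu' /=; first by rewrite uu'.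
have E i m' : cross_pairing ls m' (fun s => u (i :: s)) =
              cross_pairing ls m' (fun s => u' (i :: s)).
  by apply: IH => s sE; apply: uu'; rewrite /= sE.
by case: pickP => [i _|_]; case: pickP => [j _|_] //; rewrite !E.
Qed.

Lemma cross_pairingB ls m u u' :
  cross_pairing ls m (fun s => u s - u' s) =
  cross_pairing ls m u - cross_pairing ls m u'.
Proof.
elim: ls m u u' => [|l ls IH] m u u' /=; first by rewrite mcoeffB.
by case: pickP => [i _|_]; case: pickP => [j _|_]; rewrite ?IH ?subrr //; ring.
Qed.

Lemma cross_pairing0 ls m : cross_pairing ls m (fun=> 0) = 0.
Proof.
rewrite -(subrr (cross_pairing ls m (fun=> 0))) -cross_pairingB.
by apply: eq_cross_pairing => s _; rewrite subrr.
Qed.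

Lemma cross_pairingX ls m i u :
  cross_pairing ls (m + U_(i))%MM (fun s => 'X_i * u s) = cross_pairing ls m u.
Proof.
elim: ls m u => [|l ls IH] m u /=; first by rewrite mulrC addmC mcoeffMX.
have E j : cross_pairing ls (m + U_(i) + U_(j))%MM (fun s =>
  'X_i * u (j :: s)) =
           cross_pairing ls (m + U_(j))%MM (fun s => u (j :: s)).
  by rewrite -addmA (addmC U_(i)%MM) addmA IH.
by case: pickP => [a _|_]; case: pickP => [b _|_]; rewrite ?E ?IH.
Qed.

Lemma cross_pairingX0 ls m i u : m i = 0%N -> ~~ has (in_block i) ls ->
  cross_pairing ls m (fun s => 'X_i * u s) = 0.
Proof.
elim: ls m u => [|l ls IH] m u mi /=.
  move=> _; apply: contraTeq isT; rewrite -mcoeff_msupp => /msuppM_le.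
  case/allpairsP => -[m1 m2] /= [+ _ mE].
  by rewrite msuppX inE => /eqP m1E; move: mi; rewrite mE m1E mnmDE mnm1E eqxx.
rewrite negb_or {1}/in_block in_setU negb_or => /andP[/andP[i1 i2] i_ls].
case: pickP => [a /= a1|_]; case: pickP => [b /= b2|_] //;
  rewrite ?IH ?subrr //.
- by rewrite mnmDE mi mnm1E; case: eqP a1 i1 => // ->; case: (_ \in _).
- by rewrite mnmDE mi mnm1E; case: eqP b2 i2 => // ->; case: (_ \in _).
Qed.

Definition sub1_blocks ls : Prop := forall i, (count (in_block i) ls <= 1)%N.

Lemma sub1_blocks_tail l ls : sub1_blocks (l :: ls) -> sub1_blocks ls.
Proof. by move=> H i; have /= := H i; lia. Qed.

Lemma sub1_blocks_head l ls i :
  sub1_blocks (l :: ls) -> in_block i l -> ~~ has (in_block i) ls.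
Proof. by move=> /(_ i) /= + il; rewrite il has_count; lia. Qed.

Lemma in_block1 l i : i \in l.1 -> in_block i l.
Proof. by rewrite /in_block inE => ->. Qed.

Lemma in_block2 l i : i \in l.2 -> in_block i l.
Proof. by rewrite /in_block inE => ->; rewrite orbT. Qed.

(** The pairing kills coboundaries because a cycle has no boundary: the two
    choices in the first pair receive the same coefficient with opposite
    signs. For an isolated vertex the coboundary term is divisible by x_i,
    while the exponent read off has no x_i. *)
Lemma cross_pairing_koszul ls m u : sub1_blocks ls ->
  (forall l, l \in ls -> l.1 = set0 -> forall i, i \in l.2 -> m i = 0%N) ->
  cross_pairing ls m (koszul u) = 0.
Proof.
elim: ls m u => [|l ls IH] m u ls1 iso /=; first by rewrite mcoeff0.
have step i m' : in_block i l -> (m' = m \/ m' = (m + U_(i))%MM) ->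
    cross_pairing ls m' (fun s => koszul u (i :: s)) =
    cross_pairing ls m' (fun s => 'X_i * u s).
  move=> il m'E; rewrite cross_pairingB [X in _ - X](IH m') ?subr0 //.
    exact: sub1_blocks_tail ls1.
  move=> l' l'ls l'0 j jl'.
  have mj : m j = 0%N by apply: iso jl' => //; rewrite inE l'ls orbT.
  case: m'E => -> //; rewrite mnmDE mj mnm1E; case: eqP => // ij; subst j.
  have /hasPn := sub1_blocks_head ls1 il.
  by move=> /(_ l' l'ls); rewrite in_block2.
case: pickP => [a /= a1|no_a]; case: pickP => [b /= b2|_] //.
  rewrite !step; [|exact: in_block1|by right|exact: in_block2|by right].
  by rewrite !cross_pairingX subrr.
have l0 : l.1 = set0 by apply/setP => i; rewrite inE; apply: no_a.
have bl := in_block2 b2.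
rewrite step //; last by left.
apply: cross_pairingX0; last exact: sub1_blocks_head bl.
by apply: iso b2; rewrite ?mem_head.
Qed.

Lemma block_cochain_cons0 ls i s :
  ~~ has (in_block i) ls -> block_cochain ls (i :: s) = 0.
Proof.
elim: ls s => [//|l ls IH] s /=; rewrite negb_or => /andP[il i_ls].
rewrite /block_form; case: ifP => [/in_block2|_]; first by rewrite (negPf il).
rewrite mul0r sub0r wedge_eq0 ?oppr0 // => t _.
exact: IH.
Qed.

(** Only one choice contributes: the form of a block vanishes on the vertices
    chosen from its first side and, by [block_cochain_cons0], on those of the
    other blocks. *)
Lemma cross_pairing_block_cochain ls m : sub1_blocks ls ->
  (forall l, l \in ls -> [disjoint l.1 & l.2] /\ l.2 != set0) ->
  cross_pairing ls m (fun s => 'X_[m] * block_cochain ls s) = 1.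
Proof.
elim: ls m => [|l ls IH] m ls1 dis /=.
  by rewrite mulr1 mcoeffX eqxx.
have [l12 l2n0] := dis l (mem_head _ _).
have wz i s : in_block i l ->
    wedge (block_form l) (fun t => block_cochain ls (i :: t)) s = 0.
  move=> il; rewrite wedge_eq0 // => t _.
  exact/block_cochain_cons0/(sub1_blocks_head ls1).
have {}IH := IH _ (sub1_blocks_tail ls1) _.
have dis' l' : l' \in ls -> [disjoint l'.1 & l'.2] /\ l'.2 != set0.
  by move=> l'ls; apply: dis; rewrite inE l'ls orbT.
case: (pickP (mem l.2)) => [b /= b2|no_b]; last first.
  by case/set0Pn: l2n0 => b; rewrite -[_ \in _]/(mem l.2 b) no_b.
case: pickP => [a /= a1|no_a].
  have a2 : a \in l.2 = false by apply: (disjointFr l12).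
  have l1n0 : l.1 == set0 = false by apply/eqP => l0; move: a1; rewrite l0 inE.
  rewrite (@eq_cross_pairing ls _ _ (fun s =>
    'X_b * ('X_[m] * block_cochain ls s))).
    rewrite cross_pairingX IH // (@eq_cross_pairing ls _ _ (fun=> 0)).
      by rewrite cross_pairing0 subr0.
    move=> s _; rewrite wz ?subr0 ?in_block1 //.
    by rewrite /block_form a2 mul0r mulr0.
  move=> s _; rewrite wz ?subr0 ?in_block2 //.
  by rewrite /block_form b2 l1n0; ring.
have l0 : l.1 = set0 by apply/setP => i; rewrite inE; apply: no_a.
rewrite -[RHS](IH m) //; apply: eq_cross_pairing => s _.
rewrite wz ?subr0 ?in_block2 //.
by rewrite /block_form b2 l0 eqxx mul1r.
Qed.

Lemma wedge_block_form l ls s :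
  l \in ls -> wedge (block_form l) (block_cochain ls) s = 0.
Proof.
elim: ls s => [//|l' ls IH] s; rewrite inE => /orP[/eqP ->|l_ls] /=.
  exact: wedge_sq.
rewrite wedgeC wedge_eq0 ?oppr0 // => t _.
exact: IH.
Qed.

Lemma supp_in_submodule (P : pred 'X_{1..n}) :
  (forall m1 m2, P m2 -> P (m1 + m2)%MM) -> submodule (@supp_in K n P).
Proof.
move=> Pup; split; [exact: supp_in0|exact: supp_inD|].
by move=> c f; apply: supp_inMr.
Qed.

Definition meets (A : {set 'I_n}) m : bool := [exists i in A, (0 < m i)%N].

Lemma meetsP A m : reflect (exists2 i, i \in A & (0 < m i)%N) (meets A m).
Proof. exact: exists_inP. Qed.

Lemma meetsDl A m1 m2 : meets A m2 -> meets A (m1 + m2)%MM.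
Proof.
move=> /meetsP[i iA im]; apply/meetsP; exists i => //.
by rewrite mnmDE; lia.
Qed.

Lemma meetsU A i : i \in A -> meets A U_(i)%MM.
Proof. by move=> iA; apply/meetsP; exists i; rewrite // mnm1E eqxx. Qed.

Lemma block_cochain_meets l ls s : l \in ls -> l.1 != set0 ->
  supp_in (meets l.2) (block_cochain ls s).
Proof.
move=> l_ls l1; elim: ls l_ls s => [//|l' ls IH]; rewrite inE.
case/orP => [/eqP <-|l_ls] s /=.
  apply: (@wedge_inl _ _ (supp_in (meets l.2))) => [|i];
    first exact/supp_in_submodule/meetsDl.
  rewrite /block_form (negPf l1); case: ifP => [i2|_]; last exact: supp_in0.
  by apply: supp_inX; apply: meetsU.
apply: (@wedge_in _ _ (supp_in (meets l.2))) => [|t _];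
  first exact/supp_in_submodule/meetsDl.
exact: IH.
Qed.

Section Witness.
Variables (P : pred 'X_{1..n}) (a : 'X_{1..n}) (V : {set 'I_n}) (bs :
  seq block).
Variable (v0 : 'I_n).
Hypothesis v0V : v0 \in V.
Hypothesis blocks1 : forall i, count (in_block i) bs = (i \notin V) :> nat.
Hypothesis blocks_disj : forall l, l \in bs ->
  [disjoint l.1 & l.2] /\ l.2 != set0.
Hypothesis iso1 : forall l, l \in bs -> l.1 = set0 -> exists v, l.2 = [set v].
Hypothesis iso_a :
  forall l, l \in bs -> l.1 = set0 -> forall i, i \in l.2 -> a i = 0%N.

(** The exponents of the ideal generated by the variables of V and by the
    products x_i x_j, with i and j on the two sides of a block. *)
Definition crosses m : bool :=
  meets V m || has (fun l => meets l.1 m && meets l.2 m) bs.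

Hypothesis colonE : forall m, P (a + m)%MM = crosses m.

Let bs1 : sub1_blocks bs.
Proof. by move=> i; rewrite blocks1; case: (_ \in _). Qed.

Lemma crossesDl m1 m2 : crosses m2 -> crosses (m1 + m2)%MM.
Proof.
case/orP => [/meetsDl|/hasP[l l_bs /andP[l1 l2]]];
  first by rewrite /crosses => ->.
by apply/orP; right; apply/hasP; exists l => //; rewrite !meetsDl.
Qed.

(** The Koszul form sum of x_i dx_i is the sum of its restrictions to V, to
    the first sides, and of multiples of the block forms. The last ones die by
    [wedge_sq], the first lies in the ideal of V, and the restriction to a
    first side meets the second side through the form of the same block. *)
Lemma koszul_block_cochain s : supp_in crosses (koszul (block_cochain bs) s).
Proof.
(* mu l times the form of l is the part of the Koszul form on l.2 *)
pose mu l : S :=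
  if l.1 == set0 then if [pick i in l.2] is Some i then 'X_i else 0 else 1.
pose on (A : {set 'I_n}) i : S := if i \in A then 'X_i else 0.
have XE i : 'X_i = on V i + \sum_(l <- bs) (on l.1 i + mu l * block_form l i).
  have -> : \sum_(l <- bs) (on l.1 i + mu l * block_form l i) =
            \sum_(l <- bs | in_block i l) 'X_i.
    rewrite [RHS]big_mkcond /= big_seq [RHS]big_seq; apply: eq_bigr => l l_bs.
    have [l12 _] := blocks_disj l_bs; rewrite /in_block inE /on /block_form /mu.
    have [i1|i1] /= := boolP (i \in l.1).
      by rewrite (disjointFr l12 i1) mulr0 addr0.
    rewrite add0r; case i2: (i \in l.2); last by rewrite mulr0.
    case: ifP => [/eqP l0|_]; rewrite ?mul1r ?mulr1 //.
    have [v vE] := iso1 l_bs l0; case: pickP => [j|/(_ i)];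
      rewrite /= ?i2 // vE.
    by move: i2; rewrite vE !inE => /eqP -> /eqP ->.
  rewrite big_const_seq blocks1 /on; case: (i \in V) => /=;
    first by rewrite addr0.
  by rewrite addr0 add0r.
have Qmod := supp_in_submodule crossesDl.
have -> : koszul (block_cochain bs) s = wedge (on V) (block_cochain bs) s +
    \sum_(l <- bs) (wedge (on l.1) (block_cochain bs) s).
  rewrite /koszul (_ : (fun i => 'X_i) = fun i => 1 * on V i +
    \sum_(l <- bs) (on l.1 i + mu l * block_form l i)); last first.
    by apply/funext => i; rewrite XE mul1r.
  rewrite wedge_linl mul1r; congr (_ + _).
  suff gen ls : {subset ls <= bs} ->
      wedge (fun i => \sum_(l <- ls) (on l.1 i + mu l * block_form l i))
        (block_cochain bs) s
          = \sum_(l <- ls) wedge (on l.1) (block_cochain bs) s.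
    exact: gen.
  elim: ls => [|l ls IH] sub.
    rewrite big_nil -[RHS](wedge0l (block_cochain bs) s); congr (wedge _ _ _).
    by apply/funext => i; rewrite big_nil.
  rewrite big_cons -IH => [|l' l'ls]; last by apply: sub; rewrite inE l'ls orbT.
  rewrite (_ : (fun i => _) = fun i => mu l * block_form l i + (1 * on l.1 i +
    \sum_(l <- ls) (on l.1 i + mu l * block_form l i))); last first.
    by apply/funext => i; rewrite big_cons; ring.
  by rewrite !wedge_linl wedge_block_form ?sub ?mem_head // mulr0 add0r mul1r.
apply: supp_inD.
  apply: (@wedge_inl _ _ (supp_in crosses)) => // i; rewrite /on;
    case: ifP => iV; last exact: supp_in0.
  by apply: supp_inX; rewrite /crosses meetsU.
rewrite big_seq; apply: supp_in_sum => l l_bs.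
have [l0|l1] := eqVneq l.1 set0.
  rewrite (_ : on l.1 = fun=> 0) ?wedge0l; first exact: supp_in0.
  by apply/funext => i; rewrite /on l0 inE.
have m1 : supp_in (meets l.1) (wedge (on l.1) (block_cochain bs) s).
  apply: (@wedge_inl _ _ (supp_in (meets l.1))) => [|i];
    first exact/supp_in_submodule/meetsDl.
  rewrite /on; case: ifP => [i1|_]; last exact: supp_in0.
  by apply: supp_inX; apply: meetsU.
have m2 : supp_in (meets l.2) (wedge (on l.1) (block_cochain bs) s).
  apply: (@wedge_in _ _ (supp_in (meets l.2))) => [|t _];
    first exact/supp_in_submodule/meetsDl.
  exact: block_cochain_meets.
move=> m m_supp; apply/orP; right; apply/hasP; exists l => //.
by rewrite m1 ?m2.
Qed.

(** A choice of one vertex per block lies on one side of each block and avoids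
    V, so no exponent read off by the pairing belongs to P. *)
Lemma cross_pairing_supp_in y :
  (forall s, size s = size bs -> supp_in P (y s)) -> cross_pairing bs a y = 0.
Proof.
have gen pre ls m0 u : bs = pre ++ ls -> ~~ meets V m0 ->
    ~~ has (fun l => meets l.1 m0 && meets l.2 m0) pre ->
    ~~ has (fun l => meets (l.1 :|: l.2) m0) ls ->
    (forall s, size s = size ls -> supp_in P (u s)) ->
    cross_pairing ls (a + m0)%MM u = 0.
  elim: ls pre m0 u => [|l ls IH] pre m0 u bsE m0V m0pre m0ls uP /=.
    apply: (supp_in_coef (uP [::] erefl)).
    by rewrite colonE /crosses bsE cats0 negb_or m0V.
  move: m0ls; rewrite /= negb_or => /andP[m0l m0ls].
  have bsE' : bs = rcons pre l ++ ls by rewrite cat_rcons.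
  have uP' i s : size s = size ls -> supp_in P (u (i :: s)).
    by move=> sE; apply: uP; rewrite /= sE.
  have l0 i : in_block i l -> m0 i = 0%N.
    move=> il; apply/eqP; rewrite -leqn0 leqNgt; apply: contra m0l => ?.
    by apply/meetsP; exists i.
  have one i : in_block i l -> i \notin V /\ ~~ has (in_block i) (pre ++ ls).
    move=> il; have := blocks1 i; rewrite bsE count_cat /= il.
    by case: (i \in V) => /=; rewrite has_count count_cat; lia.
  have meetsD A i : ~~ meets A m0 -> i \notin A -> ~~ meets A (m0 + U_(i))%MM.
    move=> nA iA; apply: contra nA => /meetsP[j jA]; rewrite mnmDE mnm1E.
    case: eqP => [ij|_]; first by rewrite -ij (negPf iA) in jA.
    by rewrite addn0 => ?; apply/meetsP; exists j.
  have step i : in_block i l -> (i \in l.1) != (i \in l.2) ->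
      cross_pairing ls (a + m0 + U_(i))%MM (fun s => u (i :: s)) = 0.
    move=> il i12; have [iV] := one i il;
      rewrite has_cat negb_or => /andP[ipre ils].
    rewrite -addmA; apply: (IH _ _ _ bsE') => //; first exact: meetsD.
      rewrite has_rcons negb_or; apply/andP; split.
        have z j : j \in l.1 :|: l.2 -> j != i -> (m0 + U_(i))%MM j = 0%N.
          by move=> /l0 jl ij; rewrite mnmDE jl mnm1E eq_sym (negPf ij).
        rewrite negb_and; apply/orP; case i1 : (i \in l.1) i12 => /= i2.
          right; apply/negP => /meetsP[j j2]; rewrite z ?inE ?j2 ?orbT //.
          by apply: contraNneq i2 => <-; rewrite j2.
        left; apply/negP => /meetsP[j j1]; rewrite z ?inE ?j1 //.
        by apply: contraTneq j1 => ->; rewrite i1.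
      apply/hasPn => l' l'pre; have := hasPn ipre _ l'pre.
      rewrite /in_block inE negb_or => /andP[i1 i2].
      have := hasPn m0pre _ l'pre; rewrite !negb_and.
      by case/orP => ?; apply/orP; [left | right]; apply: meetsD.
      apply/hasPn => l' l'ls; apply: meetsD; first exact: (hasPn m0ls).
      exact: (hasPn ils).
    exact: uP'.
  have [l12 _] : [disjoint l.1 & l.2] /\ l.2 != set0.
    by apply: blocks_disj; rewrite bsE mem_cat mem_head orbT.
  case: pickP => [i /= i1|_]; case: pickP => [j /= j2|_] //.
    rewrite (step j) ?in_block2 // ?(step i) ?in_block1 ?subrr //.
      by rewrite i1 (disjointFr l12 i1).
    by rewrite j2 (disjointFl l12 j2).
  apply: (IH _ _ _ bsE') => //; last exact: uP'.
  rewrite has_rcons negb_or m0pre andbT.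
  rewrite negb_and; apply/orP; left; apply: contra m0l => /meetsP[k k1 ?].
  by apply/meetsP; exists k; rewrite // inE k1.
move=> yP; rewrite -[a]addm0; apply: (gen [::]) => //.
- by apply/meetsP => -[i _]; rewrite mnm0E.
by apply/hasPn => l _; apply/meetsP => -[i _]; rewrite mnm0E.
Qed.

Lemma seq_mul_nil (M : S -> Prop) x : seq_mul [::] M x -> x = 0.
Proof.
apply: (@ideal_gen_ind _ _ _ (fun x => x = 0)) =>
  [//|_ _ -> ->|c _ [f [g [fI _ ->]]]].
  by rewrite addr0.
suff -> : f = 0 by rewrite mul0r mulr0.
move: fI; apply: (@ideal_gen_ind _ _ _ (fun x => x = 0)) => [//|_ _ -> ->|//].
by rewrite addr0.
Qed.

(** Multiplying the product of the block forms by x^a gives a cochain zeta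
    over S that is a cocycle modulo the ideal of P. Its differential is a
    cocycle with values in that ideal, and pairing it with the cone of apex v0
    over the cross-polytope cycle recovers the pairing of zeta, which is 1.
    For the differential of a cochain y with values in the ideal this pairing
    is that of y, which is 0. *)
Lemma koszul_class_cross :
  koszul_class (supp_in P) (seq_mul [::] (@supp_in K n P)) (size bs).+1.
Proof.
pose zeta s : S := 'X_[a] * block_cochain bs s.
have [N0 _ _] := seq_mul_submodule [::] (@supp_in K n P).
exists (koszul zeta); split=> [s _|s _|y yP yz].
- rewrite /koszul wedgeZ -/(koszul _ _).
  have aX : supp_in (fun m => m == a) ('X_[a] : S) by apply: supp_inX.
  apply: (supp_inM _ aX (koszul_block_cochain (s := s))) => _ m /eqP ->.
  by rewrite colonE.
- by rewrite /koszul wedge_sq.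
pose psi u := cross_pairing bs (a + U_(v0))%MM (fun s => u (v0 :: s)).
have psi_koszul u : psi (koszul u) = cross_pairing bs a u.
  rewrite /psi (cross_pairingB _ _ (fun s => 'X_v0 * u s)) cross_pairingX.
  rewrite [X in _ - X](@cross_pairing_koszul bs _ (fun s => u (v0 :: s))) ?subr0
    //.
  move=> l l_bs l0 i i2; rewrite mnmDE (iso_a l_bs l0 i2) mnm1E.
  case: eqP => // v0i; have := blocks1 i; rewrite -v0i v0V /= => c0.
  have : has (in_block v0) bs by apply/hasP; exists l; rewrite ?v0i ?in_block2.
  by rewrite has_count c0.
have : psi (koszul zeta) = psi (koszul y).
  apply: eq_cross_pairing => s sE; apply/eqP; rewrite -subr_eq0; apply/eqP.
  by apply: (@seq_mul_nil (supp_in P)); apply: yz; rewrite /= sE.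
rewrite !psi_koszul cross_pairing_block_cochain // cross_pairing_supp_in.
  by move/eqP; rewrite oner_eq0.
by move=> s sE; apply: yP; rewrite sE.
Qed.

End Witness.

End CrossPolytopeClass.

(** * Components of the graph and their bipartitions *)

Section GraphBlocks.
Variables (n : nat) (e : rel 'I_n).
Hypothesis (e_sym : symmetric e).
Local Notation hcover := {ffun 'I_n -> 'I_3}.
Local Notation block := ({set 'I_n} * {set 'I_n})%type.
Implicit Types (C : {set 'I_n}) (c : hcover) (l : block) (m : 'X_{1..n}).

Definition bipartite_components : {set {set 'I_n}} :=
  [set C in components e | bipartite_on e C].

Definition nonbipartite_part : {set 'I_n} :=
  [set i | ~~ has (fun C => i \in C) (enum bipartite_components)].

Lemma connect_ind (Q : 'I_n -> Prop) x y :
  (forall x y, e x y -> Q x -> Q y) -> connect e x y -> Q x -> Q y.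
Proof.
move=> eQ /connectP[p]; elim: p x => [|z p IH] x /=; first by move=> _ ->.
by move=> /andP[xz zp] yE /(eQ _ _ xz); apply: IH.
Qed.

Let connect_equiv : {in [set: 'I_n] & &, equivalence_rel (connect e)}.
Proof.
move=> x y z _ _ _; split; first exact: connect0.
by move=> xy; apply: same_connect xy _; apply: sym_connect_sym.
Qed.

Lemma components_partition : partition (components e) [set: 'I_n].
Proof. exact: equivalence_partitionP connect_equiv. Qed.

Lemma component_connect C x y :
  C \in components e -> x \in C -> (y \in C) = connect e x y.
Proof.
move=> Cc xC; have /and3P[_ tI _] := components_partition.
rewrite -(def_pblock tI Cc xC); exact: pblock_equivalence_partition.
Qed.

Lemma component_edge C i j :
  C \in components e -> e i j -> (i \in C) = (j \in C).
Proof.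
move=> Cc eij; apply/idP/idP => iC;
  rewrite (component_connect _ Cc iC) connect1 //.
by rewrite e_sym.
Qed.

Lemma component_of i : exists2 C, C \in components e & i \in C.
Proof.
have /and3P[/eqP cov _ _] := components_partition.
have : i \in cover (components e) by rewrite cov inE.
by case/bigcupP => C Cc iC; exists C.
Qed.

Lemma count_bipartite_components i :
  count (fun C => i \in C) (enum bipartite_components)
    = (i \notin nonbipartite_part).
Proof.
have uniq1 : (count (fun C => i \in C) (enum bipartite_components) <= 1)%N.
  rewrite -size_filter; set s := filter _ _.
  have s_uniq : uniq s by rewrite filter_uniq ?enum_uniq.
  have sP C : C \in s -> C \in components e /\ i \in C.
    by rewrite mem_filter mem_enum inE => /andP[-> /andP[->]].
  case: s s_uniq sP => [//|C [//|D s]] /= /andP[+ _] sP.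
  have [Cc iC] := sP C (mem_head _ _).
  have [Dc iD] : D \in components e /\ i \in D by apply: sP;
    rewrite !inE eqxx orbT.
  have /and3P[_ tI _] := components_partition.
  by rewrite -(def_pblock tI Cc iC) (def_pblock tI Dc iD) mem_head.
by rewrite inE negbK has_count; case: (count _ _) uniq1 => [|[|]].
Qed.

Definition side C : {set 'I_n} :=
  odflt set0 [pick A : {set 'I_n} | [forall x in C, forall y in C,
    e x y ==> ((x \in A) != (y \in A))]].

Lemma sideP C x y : bipartite_on e C -> x \in C -> y \in C -> e x y ->
  (x \in side C) != (y \in side C).
Proof.
rewrite /side => bipC xC yC exy;
  case: pickP => [A /forall_inP/(_ x xC)/forall_inP/(_ y yC)|noA].
  by move/implyP; apply.
by case/existsP: bipC => A; rewrite noA.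
Qed.

(** Otherwise the chosen sides of all components would together form a
    bipartition of the whole graph. *)
Lemma nonbipartite_part_neq0 : ~~ bipartite e -> nonbipartite_part != set0.
Proof.
apply: contraNneq => V0.
pose A := [set i | has (fun C => (i \in C) &&
  (i \in side C)) (enum bipartite_components)].
apply/existsP; exists A; apply/forall_inP => x _; apply/forall_inP => y _.
apply/implyP => exy.
have : x \notin nonbipartite_part by rewrite V0 inE.
rewrite inE negbK => /hasP[C]; rewrite mem_enum => Cb xC.
have [Cc Cbip] : C \in components e /\ bipartite_on e C.
  by move: Cb; rewrite inE => /andP[].
have yC : y \in C by rewrite -(component_edge Cc exy).
have /and3P[_ tI _] := components_partition.
have AE z : z \in C -> (z \in A) = (z \in side C).
  move=> zC; rewrite inE; apply/hasP/idP => [[D]|zs]; last first.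
    by exists C; rewrite ?mem_enum // zC.
  rewrite mem_enum inE => /andP[Dc _] /andP[zD].
  by rewrite -(def_pblock tI Cc zC) (def_pblock tI Dc zD).
by rewrite !AE //; apply: sideP.
Qed.

(** The two sides of a bipartite component. A component without edges is a
    single vertex, which always goes to the second side. *)
Definition bipartition_block C : block :=
  if (C :\: side C == set0) || (C :&: side C == set0) then (set0, C)
  else (C :&: side C, C :\: side C).

Definition blocks : seq block :=
  [seq bipartition_block C | C <- enum bipartite_components].

Lemma blocksP l : l \in blocks -> exists C, [/\ C \in components e,
  bipartite_on e C & l = bipartition_block C].
Proof.
by case/mapP => C; rewrite mem_enum inE => /andP[Cc Cb] ->; exists C.
Qed.

Lemma bipartition_blockU C : (bipartition_block C).1 :|:
  (bipartition_block C).2 = C.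
Proof.
by rewrite /bipartition_block; case: ifP => _; rewrite /= ?set0U ?setID.
Qed.

Lemma count_blocks i :
  count (in_block i) blocks = (i \notin nonbipartite_part) :> nat.
Proof.
rewrite count_map -count_bipartite_components; apply: eq_count => C /=.
by rewrite /in_block bipartition_blockU.
Qed.

Lemma component_neq0 C : C \in components e -> C != set0.
Proof.
have /and3P[_ _ n0] := components_partition.
by move=> Cc; apply: contraNneq n0 => <-.
Qed.

Lemma component_no_edge C : C \in components e ->
  (forall x y, x \in C -> y \in C -> ~~ e x y) -> exists v, C = [set v].
Proof.
move=> Cc noe; have /set0Pn[v vC] := component_neq0 Cc; exists v.
apply/setP => w; rewrite inE (component_connect _ Cc vC).
apply/idP/eqP => [vw|-> //];
  apply: (connect_ind (Q := fun w => w = v) _ vw) => //.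
move=> x y exy xv; subst x; have := noe v y vC.
by rewrite -(component_edge Cc exy) exy => /(_ vC).
Qed.

Lemma side_empty_no_edge C : C \in components e -> bipartite_on e C ->
  (C :\: side C == set0) || (C :&: side C == set0) ->
  forall x y, x \in C -> y \in C -> ~~ e x y.
Proof.
move=> Cc Cb s0 x y xC yC; apply/negP => /(sideP Cb xC yC).
case/orP: s0 => /eqP/setP s0; have := s0 x; have := s0 y;
  rewrite !inE xC yC /= ?andbT;
  by do 2!case: (_ \in _).
Qed.

Lemma blocks_disjoint l : l \in blocks -> [disjoint l.1 & l.2] /\ l.2 != set0.
Proof.
case/blocksP => C [Cc Cb ->]; have C0 := component_neq0 Cc.
rewrite /bipartition_block; case: ifPn => [_|] /=;
  first by rewrite -setI_eq0 set0I.
rewrite negb_or => /andP[d0 _]; split=> //; rewrite -setI_eq0;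
  apply/eqP/setP => x; rewrite !inE.
by case: (x \in C); case: (x \in side C).
Qed.

Lemma blocks_isolated l : l \in blocks -> l.1 = set0 -> exists v, l.2 = [set v].
Proof.
case/blocksP => C [Cc Cb ->] l0.
suff E : (C :\: side C == set0) || (C :&: side C == set0).
  have [v vE] := component_no_edge Cc (side_empty_no_edge Cc Cb E).
  by exists v; rewrite /bipartition_block E.
by move: l0; rewrite /bipartition_block; case: ifP => // nb /= I0;
  rewrite -nb I0 eqxx orbT.
Qed.

(** An edge inside a block changes sides, and no edge leaves a component. A
    component without edges makes both memberships false. *)
Lemma blocks_edge l i j : l \in blocks -> e i j -> (i \in l.1) = (j \in l.2).
Proof.
case/blocksP => C [Cc Cb ->] eij; have E := component_edge Cc eij.
have s0 := side_empty_no_edge Cc Cb.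
rewrite /bipartition_block; case: ifPn => [d0|_].
  have jC : j \in C = false.
    apply: contraTF eij => jC; apply: (s0 d0) => //; by rewrite E.
  by rewrite /= inE jC.
rewrite /= !inE E; case jC : (j \in C); rewrite ?andbF //.
by have := sideP Cb _ jC eij; rewrite E jC => /(_ isT);
  do 2!case: (_ \in side C).
Qed.

(** Covers of this kind are those of least possible weight on a product of
    edges in which all edges occur. *)
Definition tight c : Prop := forall i j, e i j -> (c i + c j = 2)%N.

(** Along an edge a tight cover takes values 0 and 2, or 1 and 1. Being
    different from 1 therefore propagates through the component, and the zeros
    of c would be one side of a bipartition. *)
Lemma tight_nonbipartite c i : tight c -> i \in nonbipartite_part ->
  c i = 1%N :> nat.
Proof.
move=> tc iV; apply/eqP; apply: contraTT iV => ci.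
have [C Cc iC] := component_of i; rewrite inE negbK; apply/hasP; exists C => //.
rewrite mem_enum inE Cc /=.
have c1 x : x \in C -> c x != 1%N :> nat.
  rewrite (component_connect _ Cc iC) => ix.
  apply: (connect_ind (Q := fun x => c x != 1%N :> nat) _ ix) => // y z /tc;
    lia.
apply/existsP; exists [set x | c x == 0%N :> nat].
apply/forall_inP => x xC; apply/forall_inP => y yC; apply/implyP => /tc.
by rewrite !inE; have := c1 x xC; have := c1 y yC; lia.
Qed.

Lemma tight_blocks c l i j : tight c -> l \in blocks -> i \in l.1 ->
  j \in l.2 ->
  (c i + c j = 2)%N.
Proof.
move=> tc l_bs i1 j2; have [l12 _] := blocks_disjoint l_bs.
have [C [Cc Cb lE]] := blocksP l_bs.
have inC x : x \in C = (x \in l.1) || (x \in l.2).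
  by rewrite lE -[in LHS](bipartition_blockU C) inE.
pose Q x := (x \in l.1 -> c x = c i :> nat) /\ (x \in l.2 -> c x + c i = 2)%N.
suff [_ /(_ j2)] : Q j by rewrite addnC.
have ij : connect e i j by rewrite -(component_connect _ Cc) inC ?i1 ?j2 ?orbT.
apply: (connect_ind (Q := Q) _ ij) => [x y exy [Q1 Q2]|]; last first.
  by split=> //; rewrite (disjointFr l12 i1).
move: (tc x y exy) => xy; split=> [y1|y2].
  have x2 : x \in l.2.
    by rewrite -(blocks_edge (j := x) l_bs (i := y)) 1?e_sym.
  by move: xy (Q2 x2); clear; lia.
have x1 : x \in l.1 by rewrite (blocks_edge l_bs exy).
by move: xy (Q1 x1); clear; lia.
Qed.

Lemma size_blocks : size blocks = num_bipartite_components e.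
Proof. by rewrite size_map -cardE. Qed.

End GraphBlocks.

(** * A colon ideal of the integral closure *)

Section ColonIdeal.
Variables (n : nat) (e : rel 'I_n).
Hypothesis (e_sym : symmetric e) (e_irr : irreflexive e).
Variables (k : nat) (u w v0 : 'I_n).
Local Notation hcover := {ffun 'I_n -> 'I_3}.
Local Notation V := (nonbipartite_part e).
Local Notation num_arcs := #|[pred p : 'I_n * 'I_n | e p.1 p.2]|.
Hypothesis (euw : e u w) (v0V : v0 \in V) (k_large : (num_arcs < k)%N).
Implicit Types (c : hcover) (m : 'X_{1..n}).

(** The product of the edges x_i x_j over all arcs, hence the square of the
    product of all edges, times enough copies of one more edge to reach k - 1
    edges, times one variable of the non-bipartite part. *)
Definition corner : 'X_{1..n} :=
  (\sum_(p : 'I_n * 'I_n | e p.1 p.2) (U_(p.1) + U_(p.2)) +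
   (U_(u) + U_(w)) *+ (k.-1 - num_arcs) + U_(v0))%MM.

Lemma weight_corner c : weight [set: 'I_n] c corner =
  (\sum_(p : 'I_n * 'I_n | e p.1 p.2) (c p.1 + c p.2) +
   (c u + c w) * (k.-1 - num_arcs) + c v0)%N.
Proof.
have w1 i : weight [set: 'I_n] c U_(i)%MM = c i by rewrite weight1 inE.
rewrite /corner !weightD w1; congr (_ + _ + _)%N.
  rewrite (big_morph _ (weightD [set: 'I_n] c) (weight0 _ c)).
  by apply: eq_bigr => p _; rewrite weightD !w1.
elim: (_ - _)%N => [|t IH]; first by rewrite mulm0n weight0 muln0.
by rewrite mulmS !weightD IH !w1 mulnS.
Qed.

Lemma weight_corner_tight c : tight e c ->
  weight [set: 'I_n] c corner = (2 * k.-1 + c v0)%N.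
Proof.
move=> tc; rewrite weight_corner (tc u w euw).
rewrite (eq_bigr (fun=> 2)) => [|p /tc //].
have -> : (\sum_(p : 'I_n * 'I_n | e p.1 p.2) 2 = 2 * num_arcs)%N.
  by rewrite sum_nat_const mulnC.
lia.
Qed.

(** An edge that is not tight occurs as two arcs, so it raises the weight of
    the k - 1 edges from 2(k - 1) to at least 2k. *)
Lemma weight_corner_not_tight c : half_cover e c -> ~ tight e c ->
  (2 * k <= weight [set: 'I_n] c corner)%N.
Proof.
move=> /half_coverP cov ntc.
have [i [j [eij cij]]] : exists i j, e i j /\ (2 < c i + c j)%N.
  have [/existsP[i /existsP[j /andP[eij cij]]]|none] :=
    boolP [exists i, exists j, e i j && (2 < c i + c j)%N].
    by exists i, j.
  case: ntc => i j eij; apply/eqP; rewrite eqn_leq cov // andbT leqNgt.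
  apply: contra none => cij; apply/existsP; exists i; apply/existsP; exists j.
  by rewrite eij.
have eji : e j i by rewrite e_sym.
rewrite weight_corner; have cuw := cov u w euw.
suff : (2 * num_arcs + 2 <= \sum_(p :
  'I_n * 'I_n | e p.1 p.2) (c p.1 + c p.2))%N.
  have : (2 * (k.-1 - num_arcs) <= (c u + c w) * (k.-1 - num_arcs))%N.
    by rewrite leq_mul2r cuw orbT.
  lia.
have ne : (j, i) != (i, j).
  by apply: contraTneq eij => -[-> _]; rewrite e_irr.
rewrite (eq_bigr (fun p => 2 + (c p.1 + c p.2 - 2)))%N; last first.
  by move=> p ep; rewrite subnKC // cov.
rewrite big_split /= sum_nat_const mulnC leq_add2l.
rewrite (bigD1 (i, j)) //= (bigD1 (j, i)) /=; last by rewrite eji.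
by rewrite addnA; apply: leq_trans (leq_addr _ _); lia.
Qed.

Lemma weight_ge c m i : (c i * m i <= weight [set: 'I_n] c m)%N.
Proof. by rewrite /weight (bigD1 i) ?inE //= leq_addr. Qed.

Lemma weight_ge2 c m i j : i != j ->
  (c i * m i + c j * m j <= weight [set: 'I_n] c m)%N.
Proof.
move=> ij; rewrite /weight (bigD1 i) ?inE //= (bigD1 j) /=;
  last by rewrite inE eq_sym.
by rewrite addnA leq_addr.
Qed.

(** On the corner every tight cover has weight 2k - 1, since it is 1 on the
    non-bipartite part. A further variable of that part, or two variables on
    the two sides of a block, supply the missing unit. If m has neither, the
    tight cover that is 0 on the sides of the blocks met by m gives weight 0
    to m, hence 2k - 1 to the sum. Covers that are not tight impose no
    condition. *)
Lemma colon_corner m :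
  heavy e k (corner + m)%MM = crosses V (blocks e) m.
Proof.
apply/heavyP/idP => [hv|/orP cr c cov]; last first.
  rewrite weightD; have [tc|ntc] := pselect (tight e c); last first.
    exact: leq_trans (weight_corner_not_tight cov ntc) (leq_addr _ _).
  rewrite weight_corner_tight // (tight_nonbipartite e_sym tc v0V).
  case: cr => [/meetsP[i iV im]|/hasP[l l_bs
    /andP[/meetsP[i i1 im] /meetsP[j j2 jm]]]].
    have := weight_ge c m i; rewrite (tight_nonbipartite e_sym tc iV); lia.
  have [l12 _] := blocks_disjoint e_sym l_bs.
  have ij : i != j by apply: contraTneq i1 => ->; rewrite (disjointFl l12 j2).
  have := weight_ge2 c m ij; have := tight_blocks e_sym tc l_bs i1 j2; nia.
apply: contraT; rewrite negb_or => /andP[mV mbs].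
(* c is 1 on V; on a block it is 0 on a side containing the variables of m
   in that block, and 2 on the other side *)
pose two_at (i : 'I_n) :=
  has (fun l : {set 'I_n} * {set 'I_n} =>
  if meets l.1 m then i \in l.2 else i \in l.1) (blocks e).
pose c : hcover :=
  [ffun i => if i \in V then inord 1 else if two_at i then ord_max else ord0].
have cE i : c i = (if i \in V then 1 else (two_at i).*2)%N :> nat.
  by rewrite ffunE; case: ifP => _; [rewrite inordK | case: (two_at i)].
have uniq_block l l' i : l \in blocks e -> l' \in blocks e ->
    in_block i l -> in_block i l' -> l = l'.
  move=> l_bs l'_bs il il'; have := count_blocks e_sym i; rewrite -size_filter.
  have : l \in [seq x <- blocks e | in_block i x] by rewrite mem_filter il.
  have : l' \in [seq x <- blocks e | in_block i x] by rewrite mem_filter il'.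
  case: [seq _ <- _ | _] => [//|x [|y s]]; last by case: (i \in _).
  by rewrite !inE => /eqP -> /eqP ->.
have hE i l : l \in blocks e -> in_block i l ->
    two_at i = if meets l.1 m then i \in l.2 else i \in l.1.
  move=> l_bs il; apply/hasP/idP => [[l' l'_bs il']|il']; last by exists l.
  rewrite (uniq_block l l' i) //; move: il'; case: ifP => _.
    exact: in_block2.
  exact: in_block1.
have notV i l : l \in blocks e -> in_block i l -> i \in V = false.
  move=> l_bs il; have := count_blocks e_sym i; case: (i \in V) => //= /eqP.
  by rewrite -leqn0 leqNgt -has_count => /hasP; case; exists l.
have blockOf i : i \notin V -> exists2 l, l \in blocks e & in_block i l.
  move=> iV; apply/hasP; rewrite has_count; have -> := count_blocks e_sym i;
    by rewrite iV.
have tc : tight e c.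
  move=> i j eij; rewrite !cE.
  have VE x y : e x y -> y \in V = false -> x \in V = false.
    move=> exy /negbT /blockOf[l l_bs yl]; apply: (notV x l) => //.
    have eyx : e y x by rewrite e_sym.
    move: yl; rewrite /in_block !inE (blocks_edge e_sym l_bs exy).
    by rewrite -(blocks_edge e_sym l_bs eyx) orbC.
  have [iV|iV] := boolP (i \in V).
    case jV : (j \in V) => //; by rewrite (VE i j) in iV.
  have eji : e j i by rewrite e_sym.
  rewrite (VE j i) ?(negbTE iV) //; have [l l_bs il] := blockOf i iV.
  have E1 := blocks_edge e_sym l_bs eij; have E2 := blocks_edge e_sym l_bs eji.
  have jl : in_block j l by move: il; rewrite /in_block !inE E1 -E2 orbC.
  have [l12 _] := blocks_disjoint e_sym l_bs.
  rewrite (hE i l) // (hE j l) // E1 E2; move: il; rewrite /in_block inE E1.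
  case j2 : (j \in l.2).
    by have := disjointFl l12 j2; rewrite E2 => ->; case: ifP.
  by move=> /= ->; case: ifP.
have := hv c (_ : half_cover e c);
  rewrite weightD weight_corner_tight // cE v0V.
have -> : weight [set: 'I_n] c m = 0%N.
  rewrite /weight big1 // => i _; rewrite cE; have [iV|iV] := boolP (i \in V).
    case: (posnP (m i)) => [->|im]; first by rewrite muln0.
    by case/negP: mV; apply/meetsP; exists i.
  have [l l_bs il] := blockOf i iV; rewrite (hE i l) //.
  case: (posnP (m i)) => [->|im]; first by rewrite muln0.
  have := hasPn mbs l l_bs; rewrite negb_and; move: il; rewrite /in_block inE.
  have [l12 _] := blocks_disjoint e_sym l_bs.
  case: ifP => [_ _ /= m2|/negbT m1 _ _].
    case i2 : (i \in l.2) => //; by case/negP: m2; apply/meetsP; exists i.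
  case i1 : (i \in l.1) => //; by case/negP: m1; apply/meetsP; exists i.
move=> H; have := H _; rewrite addn0 => {}H.
suff : (2 * k <= 2 * k.-1 + 1)%N by lia.
by apply: H; apply/half_coverP => i j /tc ->.
Qed.

(** No arc passes through an isolated vertex, and v0 lies outside the blocks. *)
Lemma corner_isolated l : l \in blocks e -> l.1 = set0 ->
  forall i, i \in l.2 -> corner i = 0%N.
Proof.
move=> l_bs l1 i i2.
have noe j : e i j = false.
  apply/negP => eij; have := blocks_edge e_sym l_bs (i := j) (j := i).
  by rewrite e_sym i2 l1 inE => /(_ eij).
have noe' j : e j i = false by rewrite e_sym.
have iv0 : v0 == i = false.
  apply/negP => /eqP v0i; have := count_blocks e_sym i; rewrite -{2}v0i v0V /=.
  by move/eqP; rewrite -leqn0 leqNgt -has_count => /hasP; case; exists l;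
    rewrite ?in_block2.
rewrite !mnmDE mulmnE mnmDE !mnm1E iv0 mnm_sumE big1 => [|p ep].
  by case: eqP euw => [->|_]; rewrite ?noe // => _; case: eqP euw => [->|_] //;
    rewrite noe'.
rewrite mnmDE !mnm1E; case: eqP ep => [->|_]; first by rewrite noe.
by case: eqP => [->|_] //; rewrite noe'.
Qed.

End ColonIdeal.

(** * Depth and Stanley depth *)

Lemma depth_le_koszul_class (K : fieldType) (n : nat) (M : {mpoly K[n]} ->
  Prop) d f :
  submodule M -> M f -> f != 0 -> koszul_class M (seq_mul [::] M) d ->
  enat_le (depth M) (Fin d).
Proof.
move=> Mmod Mf f0 cls; rewrite /depth; case: asboolP => [M0|_].
  by move: f0; rewrite (M0 f Mf) eqxx.
apply: enat_sup_le => _ [fs [fs_irr fs_reg ->]] /=.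
exact: regular_sequence_le_koszul cls.
Qed.

Section DepthAndStanleyDepth.
Variables (K : fieldType) (n : nat) (e : rel 'I_n).
Hypothesis (e_sym : symmetric e) (e_irr : irreflexive e).

Lemma integral_closure_edge_ideal_pow k :
  integral_closure (ideal_pow (@edge_ideal K n e) k) = supp_in (heavy e k).
Proof.
by apply/funext => f; apply/propext/integral_closure_edge_ideal_powP.
Qed.

Lemma sdepth_ge_bipartite_components k : ~~ bipartite e ->
  enat_le (Fin (num_bipartite_components e + 1))
          (sdepth (@supp_in K n (heavy e k))).
Proof.
move=> nonbip; apply: sdepth_ge_of_box_partition.
pose ls := enum (bipartite_components e).
have lsP C : C \in ls -> C \in components e /\ bipartite_on e C.
  by rewrite mem_enum inE => /andP[].
have cnt (i : 'I_n) :
  count (fun C : {set 'I_n} => i \in C) ls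
  = (i \notin nonbipartite_part e) :> nat.
  by rewrite count_bipartite_components.
have closed C : C \in ls -> edge_closed e C.
  by move=> /lsP[Cc _] i j; apply: component_edge.
have U_setT : foldr (fun W U => W :|: U) (nonbipartite_part e) ls = [set: 'I_n].
  apply/setP => i; rewrite inE.
  suff -> (s : seq {set 'I_n}) :
    (i \in foldr (fun W U => W :|: U) (nonbipartite_part e) s) =
      has (fun C : {set 'I_n} => i \in C) s || (i \in nonbipartite_part e).
    by rewrite inE orbN.
  by elim: s => //= W s IH; rewrite inE IH orbA.
have -> : num_bipartite_components e = size ls by rewrite -cardE.
rewrite addn1 -U_setT.
apply: eq_box_partition
  (threshold_box_partition (e := e) (2 * k) (2 * k) _ _ _).
- by move=> a; rewrite (heavy_blocks _ _ closed cnt).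
- exact: nonbipartite_part_neq0.
- by move=> C Cls; have [Cc Cb] := lsP C Cls; split=> //;
    [exact: component_neq0 | exact: closed].
by move=> i; rewrite cnt.
Qed.

Lemma depth_le_bipartite_components k : ~~ bipartite e ->
  (#|[pred p : 'I_n * 'I_n | e p.1 p.2]| < k)%N ->
  enat_le (depth (@supp_in K n (heavy e k)))
    (Fin (num_bipartite_components e + 1)).
Proof.
move=> nonbip k_large.
have /set0Pn[v0 v0V] := nonbipartite_part_neq0 e_sym nonbip.
have [u [w euw]] : exists u w, e u w.
  have [/existsP[u /existsP[w euw]]|noe] := boolP [exists u, exists w, e u w].
    by exists u, w.
  case/negP: nonbip; apply/existsP; exists set0; apply/forall_inP => x _.
  apply/forall_inP => y _; apply/implyP => exy; case/negP: noe.
  by apply/existsP; exists x; apply/existsP; exists y.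
have colonE := colon_corner e_sym e_irr euw v0V k_large.
pose a := corner e k u w v0.
apply: (@depth_le_koszul_class _ _ _ _ 'X_[a + U_(v0)]).
- by apply: supp_in_submodule => m1 m2; apply: heavyDl.
- by apply: supp_inX; rewrite colonE /crosses meetsU.
- by rewrite -msupp_eq0 msuppX.
rewrite addn1 -size_blocks; apply: (koszul_class_cross (a := a) _ v0V) => //.
- exact: count_blocks.
- exact: blocks_disjoint.
- exact: blocks_isolated.
- move=> l; exact: corner_isolated.
Qed.

End DepthAndStanleyDepth.

Theorem theorem3p3 (K : fieldType) (n : nat) (e : rel 'I_n)
    (e_sym : symmetric e) (e_irr : irreflexive e)
    (e_nonbip : ~~ bipartite e) :
  (forall k : nat, (1 <= k)%N ->
     enat_le (Fin (num_bipartite_components e + 1))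
       (sdepth (integral_closure (ideal_pow (@edge_ideal K n e) k)))) /\
  (exists k0 : nat, forall k : nat, (k0 <= k)%N ->
     stanley_inequality (integral_closure (ideal_pow (@edge_ideal K n e) k))).
Proof.
split=> [k _|].
  rewrite integral_closure_edge_ideal_pow //.
  exact: sdepth_ge_bipartite_components.
exists #|[pred p : 'I_n * 'I_n | e p.1 p.2]|.+1 => k k_large.
rewrite /stanley_inequality integral_closure_edge_ideal_pow //.
apply: enat_le_trans (sdepth_ge_bipartite_components K e_sym k e_nonbip).
exact: depth_le_bipartite_components.
Qed.
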